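(* Let $T$ be a complete first-order theory with monster model $\mathcal{U}$, let $M\prec\mathcal{U}$ be a small model, and let $\mu\in\mathfrak{M}_x(\mathcal{U})$ be Borel-definable over $M$. (a) If $\mu$ is \emph{fim} over $M$, then $\mu$ is self-averaging over $M$. (b) If $\mu$ is self-averaging over $M$, then $\mu$ is \emph{fam} over $M$.
   Context: $\mathfrak{M}_x(\mathcal{U})$ is the space of Keisler measures (finitely additive probability measures on $\mathcal{L}_{\mathcal{U}}$-formulas in free variables $x$), identified with regular Borel probability measures on $S_x(\mathcal{U})$. $\mu$ is $A$-invariant if $\mu(\varphi(x,b))=\mu(\varphi(x,c))$ whenever $b\equiv_A c$; then $F^\varphi_{\mu,A}\colon S_y(A)\to[0,1]$, $q\mapsto \mu(\varphi(x,b))$ for $b\models q$. $\mu$ is Borel-definable (resp. definable) over $A$ if it is $A$-invariant and every $F^\varphi_{\mu,A}$ is Borel (resp. continuous). For $\bar a=(a_1,\dots,a_n)$, $\operatorname{Av}(\bar a)=\frac1n\sum_i\delta_{a_i}$. Morley product: if $\mu$ is Borel-definable over $A$, $(\mu\otimes\nu)(\varphi(x,y,b))=\int_{S_y(Ab)}F^{\varphi}_{\mu,Ab}\,d(\nu|_{Ab})$; $\mu^{(1)}=\mu(x_0)$, $\mu^{(n+1)}(x_0,\dots,x_n)=\mu(x_0)\otimes\mu^{(n)}(x_1,\dots,x_n)$, $\mu^{(\omega)}=\bigcup_n\mu^{(n)}$. $\mu$ is \emph{fim} over $M$ if for every $\mathcal{L}$-formula $\varphi(x,y)$ there are consistent $\mathcal{L}_M$-formulas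 $\theta_n(x_1,\dots,x_n)$, $n\ge1$, such that (i) for every $\epsilon>0$ there is $k(\epsilon)$ with: if $n\ge k(\epsilon)$ and $\mathcal{U}\models\theta_n(\bar a)$ then $|\mu(\varphi(x,b))-\operatorname{Av}(\bar a)(\varphi(x,b))|<\epsilon$ for all $b\in\mathcal{U}^y$; (ii) $\lim_n\mu^{(n)}(\theta_n)=1$. $\mu$ is \emph{fam} over $M$ if for every $\mathcal{L}$-formula $\varphi(x,y)$ and $\epsilon>0$ there is a finite tuple $\bar a$ from $M^x$ with $|\mu(\varphi(x,b))-\operatorname{Av}(\bar a)(\varphi(x,b))|<\epsilon$ for all $b\in\mathcal{U}^y$. With $x_{<\omega}$ variables each of sort $x$, a Keisler–Morley measure in $\mu$ over $M$ is $\lambda\in\mathfrak{M}_{x_{<\omega}}(\mathcal{U})$ with $\lambda|_M=\mu^{(\omega)}|_M$; $\mathrm{KM}(\mu/M)$ is the set of these. A Borel-definable-over-$M$ measure $\mu$ is self-averaging over $M$ if for every $\mathcal{L}_{\mathcal{U}}$-formula $\varphi(x)$ and every $\lambda\in\mathrm{KM}(\mu/M)$, $\lim_{i\to\infty}\lambda(\varphi(x_i))=\mu(\varphi(x))$. *)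

(* Defs.v *)
From HB Require Import structures.
From mathcomp Require Import all_boot all_order all_algebra.
From mathcomp Require Import all_classical all_reals all_analysis.

Set Implicit Arguments.
Unset Strict Implicit.
Unset Printing Implicit Defensive.

Import Order.TTheory GRing.Theory Num.Theory.
Import numFieldNormedType.Exports.
Local Open Scope classical_set_scope.
Local Open Scope card_scope.
Local Open Scope ring_scope.

(** [formula L V] is the type of first-order [L]-formulas (with equality) whose
  free variables belong to [V].  A tuple of variables [x] is given by its index
  type [X].  Parameters are treated as extra variables:
    - an [L]-formula [phi(x,y)] is an element of [formula L (X + Y)];
    - for [A : set U], an [L_A]-formula [phi(x)] is an element of
      [formula L (X + A)], and an [L_U]-formula of [formula L (X + U)].  *)

Record language := Language {
  funsym : Type;
  funarity : funsym -> nat;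
  relsym : Type;
  relarity : relsym -> nat }.

Inductive term (L : language) (V : Type) : Type :=
| Var of V
| App (f : funsym L) of ('I_(funarity f) -> term L V).

(** In [Fall p], the variable [None] of [p] is the quantified one. *)
Inductive formula (L : language) (V : Type) : Type :=
| Fbot
| Feq of term L V & term L V
| Frel (r : relsym L) of ('I_(relarity r) -> term L V)
| Fimp of formula L V & formula L V
| Fall of formula L (option V).

Arguments Fbot {L V}.

Definition Fneg L (V : Type) (p : formula L V) := Fimp p Fbot.
Definition Ftop {L} {V : Type} : formula L V := Fneg Fbot.
Definition Fdisj L (V : Type) (p q : formula L V) := Fimp (Fneg p) q.
Definition Fconj L (V : Type) (p q : formula L V) := Fneg (Fimp p (Fneg q)).

Fixpoint trename L (V W : Type) (s : V -> W) (t : term L V) : term L W :=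
  match t with
  | Var v => Var L (s v)
  | App f ts => App (fun i => trename s (ts i))
  end.

Fixpoint frename L (V W : Type) (s : V -> W) (p : formula L V) : formula L W :=
  match p with
  | Fbot => Fbot
  | Feq t u => Feq (trename s t) (trename s u)
  | Frel r ts => Frel (fun i => trename s (ts i))
  | Fimp p q => Fimp (frename s p) (frename s q)
  | Fall p => Fall (frename (omap s) p)
  end.

Fixpoint tfree L (V : Type) (t : term L V) : set V :=
  match t with
  | Var v => [set v]
  | App f ts => [set v | exists i, tfree (ts i) v]
  end.

Fixpoint ffree L (V : Type) (p : formula L V) : set V :=
  match p with
  | Fbot => set0
  | Feq t u => tfree t `|` tfree u
  | Frel r ts => [set v | exists i, tfree (ts i) v]
  | Fimp p q => ffree p `|` ffree q
  | Fall p => [set v | ffree p (Some v)]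
  end.

Record structure (L : language) := Structure {
  dom :> Type;
  dom_nonempty : inhabited dom;
  fint : forall f : funsym L, ('I_(funarity f) -> dom) -> dom;
  rint : forall r : relsym L, ('I_(relarity r) -> dom) -> Prop }.

Fixpoint teval L (U : structure L) (V : Type) (t : term L V) (v : V -> U) : U :=
  match t with
  | Var x => v x
  | App f ts => fint (fun i => teval (ts i) v)
  end.

Fixpoint sat L (U : structure L) (V : Type) (p : formula L V) :
    (V -> U) -> Prop :=
  match p with
  | Fbot => fun _ => False
  | Feq t u => fun v => teval t v = teval u v
  | Frel r ts => fun v => rint (fun i => teval (ts i) v)
  | Fimp p q => fun v => sat p v -> sat q v
  | Fall p => fun v => forall a : U, sat p (oapp v a)
  end.

Definition theory (L : language) := set (formula L void).

Definition true_in L (U : structure L) (s : formula L void) : Prop :=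
  sat s (of_void U).

Definition models L (U : structure L) (T : theory L) : Prop :=
  forall s, T s -> true_in U s.

Definition entails L (T : theory L) (s : formula L void) : Prop :=
  forall U : structure L, models U T -> true_in U s.

Definition complete_theory L (T : theory L) : Prop :=
  (exists U : structure L, models U T) /\
  (forall s, entails T s \/ entails T (Fneg s)).

Definition fun_closed L (U : structure L) (M : set U) : Prop :=
  forall (f : funsym L) (a : 'I_(funarity f) -> U),
    (forall i, M (a i)) -> M (fint a).

Lemma substructure_dom L (U : structure L) (M : set U) :
  M !=set0 -> inhabited M.
Proof. by case=> a Ma; exact: (inhabits (exist _ a (mem_set Ma))). Qed.

Definition substructure L (U : structure L) (M : set U)
    (ne : M !=set0) (cl : fun_closed M) : structure L :=
  @Structure L M (substructure_dom ne)
    (fun f a => exist _ (fint (fun i => set_val (a i)))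
       (mem_set (cl f _ (fun i => set_valP (a i)))))
    (fun r a => rint (fun i => set_val (a i))).

Definition elementary_substructure L (U : structure L) (M : set U) : Prop :=
  exists (ne : M !=set0) (cl : fun_closed M),
    forall (V : finType) (p : formula L V) (v : V -> M),
      @sat L (substructure ne cl) V p v <-> @sat L U V p (set_val \o v).

Definition sum_map (V V' W W' : Type) (s : V -> V') (t : W -> W')
    (z : V + W) : V' + W' :=
  match z with inl v => inl (s v) | inr w => inr (t w) end.

Definition sum_case (V W Z : Type) (s : V -> Z) (t : W -> Z) (z : V + W) :
    Z :=
  match z with inl v => s v | inr w => t w end.

Definition toU L (U : structure L) (A : set U) (X : Type)
    (p : formula L (X + A)) : formula L (X + U) :=
  frename (sum_map id set_val) p.

Definition subst_vars L (U : structure L) (X Y : Type) (s : X -> Y)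
    (p : formula L (X + U)) : formula L (Y + U) :=
  frename (sum_map s id) p.

Definition params L (U : structure L) (X : Type) (p : formula L (X + U)) :
    set U :=
  [set u | ffree p (inr u)].

Definition holds L (U : structure L) (X : Type) (p : formula L (X + U))
    (a : X -> U) : Prop :=
  sat p (sum_case a id).

(** [phi(x,b)] for an [L]-formula [phi(x,y)]. *)
Definition inst L (U : structure L) (X Y : Type) (p : formula L (X + Y))
    (b : Y -> U) : formula L (X + U) :=
  frename (sum_map id b) p.

(** [phi(x,b)] for an [L_U]-formula [phi(x,y)]. *)
Definition instU L (U : structure L) (X Y : Type) (p : formula L ((X + Y) + U))
    (b : Y -> U) : formula L (X + U) :=
  frename (sum_case (sum_map id b) inr) p.

Definition equiv_over L (U : structure L) (A : set U)
    (Y : Type)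
    (b c : Y -> U) : Prop :=
  forall p : formula L (Y + A), holds (toU p) b <-> holds (toU p) c.

Definition finitely_satisfiable L (U : structure L) (A : set U)
    (Y : Type)
    (p : set (formula L (Y + A))) : Prop :=
  forall F : set (formula L (Y + A)), finite_set F -> F `<=` p ->
    exists a : Y -> U, forall f, F f -> holds (toU f) a.

Definition small (K T : Type) (A : set T) : Prop := ~~ ([set: K] #<= A).

Definition saturated (K : Type) L (U : structure L) : Prop :=
  forall A : set U, small K A ->
  forall p : set (formula L (unit + A)), finitely_satisfiable p ->
    exists a : unit -> U, forall f, p f -> holds (toU f) a.

Definition automorphism L (U : structure L) (s : U -> U) : Prop :=
  [/\ bijective s,
      forall (f : funsym L) (a : 'I_(funarity f) -> U), s (fint a) = fint (s \o a)
    & forall (r : relsym L) (a : 'I_(relarity r) -> U), rint (s \o a) <-> rint a].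

Definition strongly_homogeneous (K : Type) L (U : structure L) : Prop :=
  forall A : set U, small K A ->
  forall f : A -> U,
    (forall p : formula L A, sat p (set_val : A -> U) <-> sat p f) ->
    exists s : U -> U, automorphism s /\ forall a : A, s (set_val a) = f a.

(** [U] is a monster model with respect to a cardinal [K > |L| + aleph_0]. *)
Definition monster (K : Type) L (U : structure L) : Prop :=
  [/\ small K [set: nat],
      small K [set: funsym L] /\ small K [set: relsym L],
      saturated K U
    & strongly_homogeneous K U].

(** Consistency with the theory of [U] with constants for [A] is finite
    satisfiability in [U]; maximality is completeness. *)
Definition complete_type L (U : structure L) (A : set U)
    (Y : Type)
    (p : set (formula L (Y + A))) : Prop :=
  finitely_satisfiable p /\ forall f, p f \/ p (Fneg f).

Definition types L (U : structure L) (A : set U) (Y : Type) :=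
  {p : set (formula L (Y + A)) | complete_type p}.

Definition realizes L (U : structure L) (A : set U) (Y : Type) (b : Y -> U)
    (q : types A Y) : Prop :=
  forall f, sval q f -> holds (toU f) b.

Definition clopen_of L (U : structure L) (A : set U)
    (Y : Type)
    (f : formula L (Y + A)) : set (types A Y) :=
  [set q | sval q f].

Lemma sat_conj L (U : structure L) (V : Type) (p q : formula L V) (v : V -> U) :
  sat (Fconj p q) v <-> sat p v /\ sat q v.
Proof.
split=> [/= h|[hp hq] /= h]; last exact: (h hp hq).
by split; apply: contrapT => n; apply: h => // hp hq.
Qed.

Lemma complete_type_tp L (U : structure L) (A : set U) (Y : Type) (b : Y -> U) :
  complete_type [set f : formula L (Y + A) | holds (toU f) b].
Proof.
split=> [F _ Fp|f]; first by exists b => f /Fp.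
exact: EM.
Qed.

Lemma complete_type_conj L (U : structure L) (A : set U)
    (Y : Type)
    (q : types A Y) f g :
  sval q (Fconj f g) <-> sval q f /\ sval q g.
Proof.
case: q => p [fs cp] /=.
have incons F : finite_set F -> F `<=` p ->
    ~ (forall a : Y -> U, exists2 h, F h & ~ holds (toU h) a).
  by move=> Ffin Fp n; have [a ha] := fs F Ffin Fp; have [h /ha] := n a.
have cE a : holds (toU (Fconj f g)) a <-> holds (toU f) a /\ holds (toU g) a.
  exact: sat_conj.
split=> [pc|[pf pg]].
- split.
  + case: (cp f) => // pn; exfalso.
    apply: (incons [set Fconj f g; Fneg f]).
    * by rewrite finite_setU; split; exact: finite_set1.
    * by move=> _ [] ->.
    * move=> a; have [h|h] := pselect (holds (toU f) a).
        by exists (Fneg f); [right|exact].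
      by exists (Fconj f g); [left|rewrite cE => -[]].
  + case: (cp g) => // pn; exfalso.
    apply: (incons [set Fconj f g; Fneg g]).
    * by rewrite finite_setU; split; exact: finite_set1.
    * by move=> _ [] ->.
    * move=> a; have [h|h] := pselect (holds (toU g) a).
        by exists (Fneg g); [right|exact].
      by exists (Fconj f g); [left|rewrite cE => -[]].
- case: (cp (Fconj f g)) => // pn; exfalso.
  apply: (incons [set f; g; Fneg (Fconj f g)]).
  + by rewrite !finite_setU; do ?split; exact: finite_set1.
  + by move=> _ [[]|] ->.
  + move=> a; have [hf|hf] := pselect (holds (toU f) a); last first.
      by exists f => //; left; left.
    have [hg|hg] := pselect (holds (toU g) a); last first.
      by exists g => //; left; right.
    exists (Fneg (Fconj f g)); first by right.
    by move=> n; apply: n; apply/cE.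
Qed.

HB.instance Definition _ L (U : structure L) (A : set U) (Y : Type) :=
  gen_eqMixin (types A Y).
HB.instance Definition _ L (U : structure L) (A : set U) (Y : Type) :=
  gen_choiceMixin (types A Y).

Definition types_point L (U : structure L) (A : set U) (Y : Type) : types A Y :=
  let b : Y -> U := fun=> inhabited_witness (dom_nonempty U) in
  exist _ _ (complete_type_tp A b).

HB.instance Definition _ L (U : structure L) (A : set U) (Y : Type) :=
  isPointed.Build (types A Y) (types_point A Y).

(** The sets [clopen_of f] form a base of the topology of [S_y(A)]. *)
Definition types_open L (U : structure L) (A : set U) (Y : Type) :
    set_system (types A Y) :=
  [set O | forall q, O q -> exists2 f, clopen_of f q & clopen_of f `<=` O].

Lemma types_openT L (U : structure L) (A : set U) (Y : Type) :
  @types_open L U A Y setT.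
Proof.
move=> [p [fs cp]] _; exists Ftop => //=; case: (cp Ftop) => // pn; exfalso.
have [||a /(_ (Fneg Ftop) erefl)] := fs [set Fneg Ftop].
- exact: finite_set1.
- by move=> _ ->.
- by apply.
Qed.

Lemma types_openI L (U : structure L) (A : set U) (Y : Type) :
  setI_closed (@types_open L U A Y).
Proof.
move=> O O' oO oO' q [/oO[f qf fO] /oO'[g qg gO']].
exists (Fconj f g) => [|r]; first exact/complete_type_conj.
by move=> /complete_type_conj[rf rg]; split; [exact: fO|exact: gO'].
Qed.

Lemma types_open_bigU L (U : structure L) (A : set U) (Y : Type) (I : Type)
    (F : I -> set (types A Y)) :
  (forall i, types_open (F i)) -> types_open (\bigcup_i F i).
Proof.
move=> oF q [i _ /oF[f qf fF]]; exists f => // r /fF Fr.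
by exists i.
Qed.

HB.instance Definition _ L (U : structure L) (A : set U) (Y : Type) :=
  isOpenTopological.Build (types A Y)
    (@types_openT L U A Y) (@types_openI L U A Y) (@types_open_bigU L U A Y).

Definition borel_types L (U : structure L) (A : set U) (Y : Type) :=
  g_sigma_algebraType (@open (types A Y)).

(** The type of [mu] in all that follows is [formula L (X + U) -> R]; the
    second clause says that [mu] is well defined on formulas up to
    equivalence, i.e., on definable sets. *)
Definition keisler_measure (R : realType) L (U : structure L) (X : Type)
    (mu : formula L (X + U) -> R) : Prop :=
  [/\ forall p, 0 <= mu p,
      forall p q, (forall a, holds p a <-> holds q a) -> mu p = mu q,
      mu Ftop = 1
    & forall p q, (forall a, ~ (holds p a /\ holds q a)) ->
        mu (Fdisj p q) = mu p + mu q].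

Definition restr (R : realType) L (U : structure L) (X : Type)
    (A : set U)
    (mu : formula L (X + U) -> R) : formula L (X + A) -> R :=
  fun p => mu (toU p).
Arguments restr {R L U X} A mu.

Definition regular_measure (R : realType) L (U : structure L) (A : set U)
    (Y : Type)
    (P : probability (borel_types A Y) R) : Prop :=
  forall B : set (borel_types A Y), measurable B ->
    P B = ereal_inf [set P O | O in [set O : set (types A Y) |
                                      open O /\ B `<=` O]] /\
    P B = ereal_sup [set P C | C in [set C : set (types A Y) |
                                      compact C /\ C `<=` B]].

(** The regular Borel probability measure on [S_y(A)] identified with a
    finitely additive probability measure on [L_A]-formulas: the unique one
    giving each clopen set [clopen_of f] the measure [nu f]. *)
Definition borel_ext (R : realType) L (U : structure L) (A : set U)
    (Y : Type)
    (nu : formula L (Y + A) -> R) : probability (borel_types A Y) R :=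
  get [set P : probability (borel_types A Y) R |
        regular_measure P /\ forall f, P (clopen_of f) = (nu f)%:E].

Definition invariant_over (R : realType) L (U : structure L) (X : Type)
    (A : set U)
    (mu : formula L (X + U) -> R) : Prop :=
  forall (Y : finType) (p : formula L (X + Y)) (b c : Y -> U),
    equiv_over A b c -> mu (inst p b) = mu (inst p c).

(** [F^phi_{mu,A} : S_y(A) -> R], which sends [q] to [mu(phi(x,b))] for [b]
    realizing [q].  This is meant for [mu] invariant over [A], a small [A], and
    [phi] with parameters in [A], so that the value exists and is unique. *)
Definition fiber (R : realType) L (U : structure L) (X Y : Type) (A : set U)
    (mu : formula L (X + U) -> R) (p : formula L ((X + Y) + U))
    (q : types A Y) : R :=
  get [set r | exists2 b : Y -> U, realizes b q & r = mu (instU p b)].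

Definition borel_definable (R : realType) L (U : structure L) (X : Type)
    (A : set U)
    (mu : formula L (X + U) -> R) : Prop :=
  invariant_over A mu /\
  forall (Y : finType) (p : formula L ((X + Y) + A)),
    measurable_fun [set: borel_types A Y]
      (fiber mu (toU p) : borel_types A Y -> R).

(** [mu \otimes nu], for [mu] Borel-definable over [A]; in the formula
    [phi(x,y,b)], the tuple [b] lists the parameters. *)
Definition morley (R : realType) L (U : structure L) (X Y : Type) (A : set U)
    (mu : formula L (X + U) -> R) (nu : formula L (Y + U) -> R) :
    formula L ((X + Y) + U) -> R :=
  fun p => let Ab := A `|` params p in
    \int[borel_ext (restr Ab nu)]_(q in [set: borel_types Ab Y])
      fiber mu p (q : types Ab Y).

(** The variables [x_0, ..., x_{n-1}], with [x_i] a copy of the tuple [x]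
    indexed by [X], are indexed by ['I_n * X]; those of [x_{<omega}] by
    [nat * X]. *)

Definition split_first (X : Type) n (z : 'I_n.+1 * X) : X + 'I_n * X :=
  if unlift ord0 z.1 is Some i then inr (i, z.2) else inl z.2.

(** [morley_pow A mu n] is [mu^(n+1)(x_0, ..., x_n)]. *)
Fixpoint morley_pow (R : realType) L (U : structure L) (X : Type)
    (A : set U)
    (mu : formula L (X + U) -> R) (n : nat) : formula L ('I_n.+1 * X + U) -> R :=
  match n return formula L ('I_n.+1 * X + U) -> R with
  | 0 => fun p => mu (subst_vars snd p)
  | n'.+1 => fun p =>
      morley A mu (@morley_pow R L U X A mu n')
        (subst_vars (@split_first X n'.+1) p)
  end.

Definition to_omega (X : Type) n (z : 'I_n * X) : nat * X := (nat_of_ord z.1, z.2).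

(** [mu^(omega)], the union of the [mu^(n)]. *)
Definition morley_omega (R : realType) L (U : structure L) (X : Type)
    (A : set U)
    (mu : formula L (X + U) -> R) : formula L (nat * X + U) -> R :=
  fun p => get [set r | exists n (p' : formula L ('I_n.+1 * X + U)),
    p = subst_vars (@to_omega X n.+1) p' /\ r = morley_pow A mu p'].

Definition dirac_keisler (R : realType) L (U : structure L) (X : Type)
    (a : X -> U)
    (p : formula L (X + U)) : R := (`[< holds p a >])%:R.

Definition Av (R : realType) L (U : structure L) (X : Type) n (a : 'I_n -> X -> U)
    (p : formula L (X + U)) : R :=
  n%:R^-1 * \sum_(i < n) dirac_keisler R (a i) p.

(** [theta n] is the formula [theta_{n+1}(x_1, ..., x_{n+1})] of the usual
    indexing from 1. *)
Definition fim (R : realType) L (U : structure L) (X : Type)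
    (M : set U)
    (mu : formula L (X + U) -> R) : Prop :=
  forall (Y : finType) (p : formula L (X + Y)),
  exists theta : forall n, formula L ('I_n.+1 * X + M),
    [/\ forall n, exists a : 'I_n.+1 * X -> U, holds (toU (theta n)) a,
        forall eps : R, 0 < eps -> exists k : nat,
          forall n, (k <= n.+1)%N ->
          forall a : 'I_n.+1 -> X -> U,
            holds (toU (theta n)) (fun z => a z.1 z.2) ->
          forall b : Y -> U, `|mu (inst p b) - Av R a (inst p b)| < eps
      & morley_pow M mu (toU (theta n)) @[n --> \oo] --> (1 : R)].

Definition fam (R : realType) L (U : structure L) (X : Type)
    (M : set U)
    (mu : formula L (X + U) -> R) : Prop :=
  forall (Y : finType) (p : formula L (X + Y)) (eps : R), 0 < eps ->
  exists n (a : 'I_n.+1 -> X -> U),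
    (forall i x, M (a i x)) /\
    forall b : Y -> U, `|mu (inst p b) - Av R a (inst p b)| < eps.

Definition keisler_morley (R : realType) L (U : structure L) (X : Type)
    (M : set U)
    (mu : formula L (X + U) -> R) : set (formula L (nat * X + U) -> R) :=
  [set lambda | keisler_measure lambda /\
                restr M lambda = restr M (morley_omega M mu)].

Definition self_averaging (R : realType) L (U : structure L) (X : Type)
    (M : set U)
    (mu : formula L (X + U) -> R) : Prop :=
  borel_definable M mu /\
  forall (p : formula L (X + U)) (lambda : formula L (nat * X + U) -> R),
    keisler_morley M mu lambda ->
    lambda (subst_vars (fun x => (i, x)) p) @[i --> \oo] --> mu p.

(* Main.v *)
Require Import Defs.
From HB Require Import structures.
From mathcomp Require Import all_boot all_order all_algebra.
From mathcomp Require Import finmap.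
From mathcomp Require Import all_classical all_reals all_analysis.
From mathcomp Require Import ring lra.

(** For (a), a subtuple [x_(i_0), ..., x_(i_n)] of a Keisler-Morley measure over
  [M] has the same law over [M] as [mu^(n+1)], so it satisfies [theta_n] with
  probability close to 1, and the average of the [lambda(phi(x_(i_l)))] is
  uniformly close to [mu(phi)].  If [lambda(phi(x_i))] did not converge to
  [mu(phi)], some increasing sequence of indices would violate this.

  For (b), let [lambda_F] be a convex combination of points of [M] which agrees
  with [mu^(omega)] on a finite set [F] of formulas over [M].  If [mu] is not fam,
  every convex combination [v] of the functions
  [b |-> lambda_F(phi(x_i,b))], [i < omega], is far from [b |-> mu(phi(x,b))] at
  some [b], at which a set of indices of [v]-measure bounded below is therefore
  bad.  By Ptak's combinatorial lemma there are infinitely many indices [i] such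
  that finitely many of them are always simultaneously bad for arbitrarily large
  [F].  An ultralimit of such pairs [(lambda_F, b)] is a Keisler-Morley measure
  whose values at these [phi(x_i,b)] stay away from the limit of the
  [mu(phi(x,b))].  That limit is [mu(phi(x,b'))] for the limit [b'] of the [b],
  because a limit of shifts of a Keisler-Morley measure takes the value
  [mu(phi(x,b))] at every [phi(x_i,b)].  This contradicts self-averaging. *)

Set Implicit Arguments.
Unset Strict Implicit.
Unset Printing Implicit Defensive.

Import Order.TTheory GRing.Theory Num.Theory.
Import numFieldNormedType.Exports.
Local Open Scope classical_set_scope.
Local Open Scope ring_scope.

(** * Syntax *)

(** Two obstacles shape (b). As [mu] is only Borel-definable, [b |-> mu(phi(x,b))] is not known to
    be continuous, so the limit of its values along an ultrafilter cannot be read off at [b']. It is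
    computed by sending a second Keisler-Morley measure, the same at every index, through the same
    ultrafilter and applying self-averaging to the result. Moreover, the bad [b] depends on the
    convex combination; Ptak's lemma converts bad sets of positive mass for every weight into one
    infinite set of indices that can be made bad together, finitely many at a time. A Keisler-Morley
    measure is constrained only on formulas over [M], so Morley powers are evaluated only there, as
    integrals over types over [M]. Comparing integrals with different numbers of variables requires
    regular Borel extensions to commute with restriction of types; this rests on their existence and
    uniqueness. Finite additivity is relative to a set of points, so that the same lemmas serve
    assignments in [U], assignments in [M], and assignments with the tuple [b'] held fixed. *)

Lemma trename_comp L (V W Z : Type) (s : V -> W) (t : W -> Z) (u : term L V) :
  trename t (trename s u) = trename (t \o s) u.
Proof. by elim: u => //= f ts IH; congr App; apply/funext => i; exact: IH. Qed.

Lemma frename_comp L (V W Z : Type) (s : V -> W) (t : W -> Z)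
    (p : formula L V) :
  frename t (frename s p) = frename (t \o s) p.
Proof.
elim: p W Z s t => //= {V}.
- by move=> V u v W Z s t; rewrite !trename_comp.
- by move=> V r ts W Z s t; congr Frel; apply/funext => i; rewrite trename_comp.
- by move=> V p IHp q IHq W Z s t; rewrite IHp IHq.
- move=> V p IHp W Z s t; rewrite IHp; congr (Fall (frename _ p)).
  by apply/funext; case.
Qed.

Lemma teval_trename L (U : structure L) (V W : Type) (s : V -> W)
    (u : term L V) (v : W -> U) :
  teval (trename s u) v = teval u (v \o s).
Proof. by elim: u => //= f ts IH; congr fint; apply/funext => i; exact: IH. Qed.

Lemma sat_frename L (U : structure L) (V W : Type) (s : V -> W)
    (p : formula L V) (v : W -> U) :
  sat (frename s p) v <-> sat p (v \o s).
Proof.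
elim: p W s v => //= {V}.
- by move=> V t u W s v; rewrite !teval_trename.
- move=> V r ts W s v.
  suff -> : (fun i => teval (trename s (ts i)) v) =
    (fun i => teval (ts i) (v \o s)) by [].
  by apply/funext => i; rewrite teval_trename.
- by move=> V p IHp q IHq W s v; rewrite IHp IHq.
- move=> V p IHp W s v.
  have E a : oapp v a \o omap s = oapp (v \o s) a by apply/funext; case.
  by split=> h a; have := h a; rewrite IHp E.
Qed.

Lemma tfree_trename L (V W : Type) (s : V -> W) (u : term L V) :
  tfree (trename s u) = s @` tfree u.
Proof.
elim: u => [v|f ts IH] /=; first by rewrite image_set1.
apply/seteqP; split=> [w [i]|w [v [i iv] <-]].
  by rewrite IH => -[v iv <-]; exists v => //; exists i.
by exists i; rewrite IH; exists v.
Qed.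

Lemma ffree_frename L (V W : Type) (s : V -> W) (p : formula L V) :
  ffree (frename s p) = s @` ffree p.
Proof.
elim: p W s => /= {V}.
- by move=> V W s; rewrite image_set0.
- by move=> V t u W s; rewrite !tfree_trename image_setU.
- move=> V r ts W s; apply/seteqP; split=> [w [i]|w [v [i iv] <-]].
    by rewrite tfree_trename => -[v iv <-]; exists v => //; exists i.
  by exists i; rewrite tfree_trename; exists v.
- by move=> V p IHp q IHq W s; rewrite IHp IHq image_setU.
- move=> V p IHp W s; rewrite IHp; apply/seteqP.
  split=> [w [[v|] pv //= [<-]]|w [v pv <-]].
    by exists v.
  by exists (Some v).
Qed.

Lemma finite_tfree L (V : Type) (u : term L V) : finite_set (tfree u).
Proof.
elim: u => [v|f ts IH] /=; first exact: finite_set1.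
have -> : [set v | exists i, tfree (ts i) v] = \bigcup_(i in setT) tfree (ts i).
  by apply/seteqP; split=> v [i]; [exists i|move=> _; exists i].
by apply: bigcup_finite.
Qed.

Lemma finite_ffree L (V : Type) (p : formula L V) : finite_set (ffree p).
Proof.
elim: p => /= {V}.
- by move=> V; exact: finite_set0.
- by move=> V t u; rewrite finite_setU; split; exact: finite_tfree.
- move=> V r ts.
  have -> : [set v | exists i, tfree (ts i) v] = \bigcup_(i in setT) tfree (ts i).
    by apply/seteqP; split=> v [i]; [exists i|move=> _; exists i].
  by apply: bigcup_finite => // i _; exact: finite_tfree.
- by move=> V p IHp q IHq; rewrite finite_setU.
- move=> V p IHp; apply: (@finite_preimage _ _ _ Some _ IHp).
  by move=> x y _ _ [].
Qed.

Lemma tfree_factor L (V W : Type) (h : V -> W) (u : term L W) :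
  tfree u `<=` range h -> exists u0, u = trename h u0.
Proof.
elim: u => [w|f ts IH] /= hu.
  by have [v _ <-] := hu w erefl; exists (Var L v).
have /choice[g gE] : forall i, exists u0, ts i = trename h u0.
  by move=> i; apply: IH => w iw; apply: hu; exists i.
by exists (App g) => /=; congr App; apply/funext.
Qed.

(** This strips a formula to finitely many variables or parameters, since elementarity and
    invariance are formulated with finite index types. *)
Lemma ffree_factor L (V W : Type) (h : V -> W) (p : formula L W) :
  ffree p `<=` range h -> exists p0, p = frename h p0.
Proof.
elim: p V h => {W} /=.
- by move=> W V h _; exists Fbot.
- move=> W t u V h; rewrite subUset => -[/tfree_factor[t0 ->] /tfree_factor[u0 ->]].
  by exists (Feq t0 u0).
- move=> W r ts V h hts.
  have /choice[g gE] : forall i, exists u0, ts i = trename h u0.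
    by move=> i; apply: tfree_factor => w iw; apply: hts; exists i.
  by exists (Frel g) => /=; congr Frel; apply/funext.
- move=> W p IHp q IHq V h; rewrite subUset => -[/IHp[p0 ->] /IHq[q0 ->]].
  by exists (Fimp p0 q0).
- move=> W p IHp V h hp.
  have [[w|]|p0 ->] := IHp _ (omap h).
  + by move=> /hp[v _ <-]; exists (Some v).
  + by exists None.
  by exists (Fall p0).
Qed.

Lemma finite_set_enum (W : Type) (A : set W) : finite_set A ->
  exists n (h : 'I_n -> W), A `<=` range h.
Proof.
move=> fA; have [s sE] := (@finite_seqP {classic W} A).1 fA.
exists (size s), (tnth (in_tuple s)) => w; rewrite sE /= => ws.
by have [i ->] := tnthP (in_tuple s) w ws; exists i.
Qed.

Definition Fex L (V : Type) (p : formula L (option V)) : formula L V :=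
  Fneg (Fall (Fneg p)).

Lemma sat_ex L (U : structure L) (V : Type) (p : formula L (option V))
    (v : V -> U) :
  sat (Fex p) v <-> exists a, sat p (oapp v a).
Proof.
split=> /= [h|[a pa] h]; last exact: (h a).
by apply: contrapT => n; apply: h => a pa; apply: n; exists a.
Qed.

Lemma ffree_ex L (V : Type) (p : formula L (option V)) :
  ffree (Fex p) = [set v | ffree p (Some v)].
Proof. by apply/seteqP; split=> v /=; [case=> // -[]|left; left]. Qed.

Lemma sat_neg L (U : structure L) (V : Type) (p : formula L V) (v : V -> U) :
  sat (Fneg p) v <-> ~ sat p v.
Proof. by []. Qed.

Lemma sat_disj L (U : structure L) (V : Type) (p q : formula L V) (v : V -> U) :
  sat (Fdisj p q) v <-> sat p v \/ sat q v.
Proof.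
split=> [/= h|/= [hp /(_ hp)//|//]].
by have [hp|/h] := pselect (sat p v); [left|right].
Qed.

Lemma sum_case_comp (V W V' W' Z : Type) (s : V' -> Z) (t : W' -> Z)
    (s' : V -> V') (t' : W -> W') :
  sum_case s t \o sum_map s' t' = sum_case (s \o s') (t \o t').
Proof. by apply/funext; case. Qed.

Lemma sum_map_comp (V W V' W' V2 W2 : Type) (s : V' -> V2) (t : W' -> W2)
    (s' : V -> V') (t' : W -> W') :
  sum_map s t \o sum_map s' t' = sum_map (s \o s') (t \o t').
Proof. by apply/funext; case. Qed.

(** The formula [p'] does not depend on the structure, so elementarity turns a
  solution in [U] into a solution in [M]. *)
Lemma ex_close L (Z V : Type) (p : formula L (Z + V)) :
  exists p' : formula L V, forall (U : structure L) (v : V -> U),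
    sat p' v <-> exists a : Z -> U, sat p (sum_case a v).
Proof.
(* Only finitely many variables of [Z] occur in [p]; they are quantified away one at a time along a
   list. *)
suff H (zs : seq {classic Z}) : forall p : formula L (Z + V),
    (forall z : {classic Z}, ffree p (inl z) -> z \in zs) ->
    exists p' : formula L V, forall (U : structure L) (v : V -> U),
    sat p' v <-> exists a : Z -> U, sat p (sum_case a v).
  have fin : finite_set [set z : {classic Z} | ffree p (inl z)].
    apply: (@finite_preimage _ _ _ inl _ (finite_ffree p)).
    by move=> x y _ _ [].
  have [s sE] := (finite_seqP _).1 fin.
  apply: (H s) => z pz.
  by have : [set z : {classic Z} | ffree p (inl z)] z by []; rewrite sE.
elim: zs => [|z zs IH] q qzs.
  have [|q' ->] := @ffree_factor L V (Z + V)%type inr q.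
    by move=> [z /qzs//|v _]; exists v.
  exists q' => U v; split=> [h|[a /sat_frename//]].
  by have [x] := dom_nonempty U; exists (fun=> x); apply/sat_frename.
pose s (x : Z + V) : option (Z + V) :=
  match x with
  | inl y => if (y : {classic Z}) == z then None else Some (inl y)
  | inr v => Some (inr v)
  end.
have [y|q' q'E] := IH (Fex (frename s q)).
  rewrite ffree_ex ffree_frename => -[[x|x] qx] //=.
  by case: eqP => // /eqP xz [<-]; have := qzs _ qx; rewrite inE (negbTE xz).
exists q' => U v; rewrite q'E; split=> -[a].
  move=> /sat_ex[c /sat_frename h].
  exists (fun y : {classic Z} => if y == z then c else a y).
  congr (sat q _): h; apply/funext => -[y|y] //=.
  by case: eqP.
move=> h; exists a; apply/sat_ex; exists (a z); apply/sat_frename.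
by congr (sat q _): h; apply/funext => -[y|y] //=; case: eqP => // ->.
Qed.

(** * Discrete measures and Ptak's combinatorial lemma *)

(** A list [w] of pairs (weight, point) stands for the discrete measure
  [\sum_(x <- w) x.1 \delta_(x.2)]. *)
Definition wE (R : realType) S (w : seq (R * S)) (g : S -> R) : R :=
  \sum_(x <- w) x.1 * g x.2.

Definition wprob (R : realType) S (w : seq (R * S)) : Prop :=
  (forall x, List.In x w -> 0 <= x.1) /\ wE w (fun=> 1) = 1.

Definition wbind (R : realType) S T (w : seq (R * S)) (u : S -> seq (R * T)) :
    seq (R * T) :=
  flatten [seq [seq (x.1 * y.1, y.2) | y <- u x.2] | x <- w].

Definition wmap (R : realType) S T (h : S -> T) (w : seq (R * S)) :
    seq (R * T) :=
  [seq (x.1, h x.2) | x <- w].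

Definition ind (R : realType) (P : Prop) : R := (`[< P >])%:R.

Lemma ind_ge0 (R : realType) P : 0 <= ind R P.
Proof. exact: ler0n. Qed.

Lemma ind_le1 (R : realType) P : ind R P <= 1.
Proof. by rewrite /ind; case: asbool. Qed.

Lemma indT (R : realType) (P : Prop) : P -> ind R P = 1.
Proof. by move=> p; rewrite /ind asboolT. Qed.

Lemma indF (R : realType) (P : Prop) : ~ P -> ind R P = 0.
Proof. by move=> p; rewrite /ind asboolF. Qed.

Lemma eq_ind (R : realType) (P Q : Prop) : (P <-> Q) -> ind R P = ind R Q.
Proof. by move=> PQ; congr (ind R _); apply/propext. Qed.

Section discrete_measures.
Variable R : realType.

Lemma eq_wE S (w : seq (R * S)) g g' : (forall s, g s = g' s) ->
  wE w g = wE w g'.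
Proof. by move=> gg; apply: eq_bigr => x _; rewrite gg. Qed.

Lemma wE_nil S (g : S -> R) : wE [::] g = 0.
Proof. exact: big_nil. Qed.

Lemma wE_cons S x (w : seq (R * S)) g : wE (x :: w) g = x.1 * g x.2 + wE w g.
Proof. exact: big_cons. Qed.

Lemma wE_cat S (w w' : seq (R * S)) g : wE (w ++ w') g = wE w g + wE w' g.
Proof. exact: big_cat. Qed.

Lemma wED S (w : seq (R * S)) g g' :
  wE w (fun s => g s + g' s) = wE w g + wE w g'.
Proof. by rewrite -big_split; apply: eq_bigr => x _; rewrite mulrDr. Qed.

Lemma wEZ S (w : seq (R * S)) c g : wE w (fun s => c * g s) = c * wE w g.
Proof. by rewrite /wE big_distrr; apply: eq_bigr => x _; rewrite mulrCA. Qed.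

Lemma wEB S (w : seq (R * S)) g g' :
  wE w (fun s => g s - g' s) = wE w g - wE w g'.
Proof.
rewrite wED; congr (_ + _); rewrite -mulN1r -wEZ.
by apply: eq_wE => s; rewrite mulN1r.
Qed.

Lemma wE_const S (w : seq (R * S)) c : wprob w -> wE w (fun=> c) = c.
Proof.
move=> [_ w1]; rewrite -[RHS]mulr1 -w1 -wEZ; apply: eq_wE => s.
by rewrite mulr1.
Qed.

Lemma wE_sum S (I : Type) (r : seq I) (w : seq (R * S)) (g : I -> S -> R) :
  wE w (fun s => \sum_(i <- r) g i s) = \sum_(i <- r) wE w (g i).
Proof.
rewrite /wE exchange_big; apply: eq_bigr => x _.
by rewrite big_distrr.
Qed.

Lemma wE_ge0 S (w : seq (R * S)) g : (forall x, List.In x w -> 0 <= x.1) ->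
  (forall s, 0 <= g s) -> 0 <= wE w g.
Proof.
move=> + g0; elim: w => [|x w IH] w0; first by rewrite /wE big_nil.
rewrite /wE big_cons addr_ge0//; last by apply: IH => y wy; apply: w0; right.
by rewrite mulr_ge0//; apply: w0; left.
Qed.

Lemma ler_wE S (w : seq (R * S)) g g' : wprob w ->
  (forall s, g s <= g' s) -> wE w g <= wE w g'.
Proof.
by move=> [w0 _] gg; rewrite -subr_ge0 -wEB wE_ge0// => s; rewrite subr_ge0.
Qed.

Lemma ler_norm_wE S (w : seq (R * S)) g g' : wprob w ->
  (forall s, `|g s| <= g' s) -> `|wE w g| <= wE w g'.
Proof.
move=> w1 gg; rewrite ler_norml; apply/andP; split; last first.
  by apply: ler_wE => // s; rewrite (le_trans (ler_norm _)).
rewrite -mulN1r -wEZ; apply: ler_wE => // s.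
by rewrite mulN1r; have := gg s; rewrite ler_norml => /andP[].
Qed.

Lemma wE_bind S T (w : seq (R * S)) (u : S -> seq (R * T)) g :
  wE (wbind w u) g = wE w (fun s => wE (u s) g).
Proof.
rewrite /wE /wbind big_flatten big_map; apply: eq_bigr => x _.
by rewrite big_map big_distrr; apply: eq_bigr => y _ /=; rewrite mulrA.
Qed.

Lemma wE_map S T (h : S -> T) (w : seq (R * S)) g :
  wE (wmap h w) g = wE w (g \o h).
Proof. by rewrite /wE /wmap big_map. Qed.

Lemma wprob_bind S T (w : seq (R * S)) (u : S -> seq (R * T)) : wprob w ->
  (forall s, wprob (u s)) -> wprob (wbind w u).
Proof.
move=> w1 u1; split; last first.
  rewrite wE_bind -[RHS](wE_const 1 w1); apply: eq_wE => s.
  exact: (u1 s).2.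
have : forall x, List.In x w -> 0 <= x.1 by case: w1.
elim: w {w1} => // x w IH w0 y /List.in_app_iff[|]; last first.
  by apply: IH => z wz; apply: w0; right.
move=> /List.in_map_iff[z [<- uz]] /=; rewrite mulr_ge0//.
  by apply: w0; left.
exact: (u1 x.2).1.
Qed.

Lemma wprob_map S T (h : S -> T) (w : seq (R * S)) : wprob w ->
  wprob (wmap h w).
Proof.
move=> [w0 w1]; split; last by rewrite wE_map.
by move=> y /List.in_map_iff[z [<- /w0]].
Qed.

Definition wdirac S (s : S) : seq (R * S) := [:: (1, s)].

Lemma wE_dirac S (s : S) g : wE (wdirac s) g = g s.
Proof. by rewrite /wE /wdirac big_seq1 mul1r. Qed.

Lemma wprob_dirac S (s : S) : wprob (wdirac s).
Proof. by split; [move=> x /= [<-|//] /=|rewrite wE_dirac]. Qed.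

Definition wunif n : seq (R * nat) := [seq (n%:R^-1, i) | i <- iota 0 n].

Lemma wE_unif n g : wE (wunif n) g = n%:R^-1 * \sum_(0 <= i < n) g i.
Proof.
by rewrite /wE /wunif big_map /= -big_distrr /= /index_iota subn0.
Qed.

Lemma wprob_unif n : (0 < n)%N -> wprob (wunif n).
Proof.
move=> n0; split; last first.
  by rewrite wE_unif sumr_const_nat subn0 mulVf// pnatr_eq0 -lt0n.
by move=> x /List.in_map_iff[i [<- _]] /=; rewrite invr_ge0.
Qed.

End discrete_measures.

(** * Convex combinations of weights on the natural numbers and Ptak's lemma *)

Section convex_means.
Variable R : realType.
Implicit Types (K : set (set nat)) (u : nat -> seq (R * nat)).

Definition escaping u : Prop :=
  forall N, exists m, forall l, (m <= l)%N ->
    wE (u l) (fun k => ind R (k < N)%N) = 0.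

(** The convex hull of the [u l], in dual form. *)
Definition in_hull u (v : seq (R * nat)) : Prop :=
  wprob v /\
  forall g c, (forall l, wE (u l) g <= c) -> wE v g <= c.

(** Allowing every escaping sequence [u], and not only the Dirac masses, is what makes the notion
    stable under finite unions. *)
Definition negligible_family K : Prop :=
  forall (d : R) u, 0 < d -> (forall l, wprob (u l)) -> escaping u ->
  exists v, in_hull u v /\ forall S, K S -> wE v (fun k => ind R (S k)) <= d.

Lemma in_hull_bind u c : wprob c -> (forall l, wprob (u l)) ->
  in_hull u (wbind c u).
Proof.
move=> c1 u1; split=> [|g d gd]; first exact: wprob_bind.
by rewrite wE_bind -[leRHS](wE_const d c1); exact: ler_wE.
Qed.

Lemma in_hull_trans u v w : (forall l, in_hull u (v l)) -> in_hull v w ->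
  in_hull u w.
Proof.
by move=> uv [w1 vw]; split=> // g c gc; apply: vw => l; exact: (uv l).2.
Qed.

Lemma in_hull_shift u v m : in_hull (fun l => u (m + l)%N) v -> in_hull u v.
Proof. by move=> [v1 uv]; split=> // g c gc; exact: uv. Qed.

Lemma escaping_shift u m : escaping u -> escaping (fun l => u (m + l)%N).
Proof.
move=> eu N; have [m' h] := eu N; exists m' => l ml; apply: h.
by rewrite (leq_trans ml)// leq_addl.
Qed.

Lemma in_hull_eq0 u v (P : set nat) : in_hull u v ->
    (forall l, wE (u l) (fun k => ind R (P k)) = 0) ->
  wE v (fun k => ind R (P k)) = 0.
Proof.
move=> [[v0 _] uv] P0; apply/eqP; rewrite eq_le wE_ge0// ?andbT//.
by apply: uv => l; rewrite P0.
Qed.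

(** Combinations small on [K], taken from later and later tails of [u], again form an escaping
    sequence. A combination of these that is small on [K'] stays small on [K], because such bounds
    pass to the hull. *)
Lemma negligible_setU K K' : negligible_family K -> negligible_family K' ->
  negligible_family (K `|` K').
Proof.
move=> nK nK' d u d0 u1 eu.
have /choice[v vP] : forall m, exists v, in_hull (fun l => u (m + l)%N) v /\
    forall S, K S -> wE v (fun k => ind R (S k)) <= d.
  by move=> m; apply: nK => //; exact: escaping_shift.
have [||w [vw wK']] := nK' d v d0.
- by move=> l; exact: (vP l).1.1.
- move=> N; have [m h] := eu N; exists m => l ml.
  apply: (in_hull_eq0 (vP l).1) => k; apply: h.
  by rewrite (leq_trans ml)// leq_addr.
exists w; split.
  by apply: (in_hull_trans _ vw) => l; apply: in_hull_shift (vP l).1.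
move=> S [KS|]; last exact: wK'.
by apply: vw.2 => l; exact: (vP l).2.
Qed.

Lemma negligible_bigcup (F : nat -> set (set nat)) N :
    (forall m, (m < N)%N -> negligible_family (F m)) ->
  negligible_family [set S | exists2 m, (m < N)%N & F m S].
Proof.
elim: N => [_ d u d0 u1 eu|N IH nF].
  exists (u 0); split=> [|S [m]//].
  by split=> // g c; exact.
have -> : [set S | exists2 m, (m < N.+1)%N & F m S] =
    [set S | exists2 m, (m < N)%N & F m S] `|` F N.
  apply/seteqP; split=> S [].
  - move=> m; rewrite ltnS leq_eqVlt => /predU1P[->|mN FS]; first by right.
    by left; exists m.
  - by move=> [m mN FS]; exists m => //; rewrite ltnS ltnW.
  - by exists N.
apply: negligible_setU; last exact: nF.
by apply: IH => m mN; apply: nF; rewrite ltnS ltnW.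
Qed.

Lemma wE_bounded_support (w : seq (R * nat)) :
  exists N, wE w (fun k => ind R (N <= k)%N) = 0.
Proof.
suff [N NP] : exists N, forall N', (N <= N')%N ->
    wE w (fun k => ind R (N' <= k)%N) = 0 by exists N; exact: NP.
elim: w => [|[r k] w [N NP]]; first by exists 0%N => N' _; exact: wE_nil.
exists (maxn N k.+1) => N'; rewrite geq_max => /andP[NN' kN'].
rewrite wE_cons NP// indF/= ?mulr0 ?addr0//.
by apply/negP; rewrite -ltnNge.
Qed.

(** At most one term exceeds [e], and it costs at most 1; the induction records whether it has
    already occurred. *)
Lemma sum_almost_small (a : nat -> R) e n : 0 <= e ->
    (forall l, a l <= 1) ->
    (forall l l', (l < l')%N -> e < a l -> a l' <= e) ->
  \sum_(0 <= l < n) a l <= 1 + n%:R * e.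
Proof.
move=> e0 a1 ae.
suff : \sum_(0 <= l < n) a l <= n%:R * e \/
    \sum_(0 <= l < n) a l <= 1 + n%:R * e /\
    exists2 l, (l < n)%N & e < a l.
  by move=> [h|[]//]; rewrite (le_trans h)// lerDr.
elim: n => [|n [IH|[IH [l ln la]]]].
- by left; rewrite big_geq// mul0r.
- rewrite big_nat_recr//= -natr1 mulrDl mul1r.
  have [h|h] := leP (a n) e; [left|right]; first exact: lerD.
  split; last by exists n.
  rewrite addrC lerD// (le_trans IH)// lerDl//.
- rewrite big_nat_recr//= -natr1 mulrDl mul1r addrA; right; split.
    by apply: lerD => //; exact: ae la.
  by exists l => //; rewrite ltnS ltnW.
Qed.

(** If every family [{S in K | m in S}] is negligible, averaging successive
  small convex combinations works: only one of them can be large on [S]. *)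
Lemma negligible_step K M0 :
    (forall m, (M0 <= m)%N -> negligible_family [set S | K S /\ S m]) ->
  negligible_family K.
Proof.
move=> nK d u d0 u1 eu.
(* Dropping the first [m0] terms removes all mass below [M0], where nothing is assumed about [K]. *)
have [m0 um0] := eu M0.
pose u' l := u (m0 + l)%N.
have eu' : escaping u' by exact: escaping_shift.
have u'M0 l : wE (u' l) (fun k => ind R (k < M0)%N) = 0.
  by apply: um0; rewrite leq_addr.
pose e := d / 2.
have e0 : 0 < e by rewrite divr_gt0.
have /choice[f fP] : forall N, exists v, in_hull u' v /\
    forall m S, (M0 <= m < N)%N -> K S -> S m ->
      wE v (fun k => ind R (S k)) <= e.
  have u'1 l : wprob (u' l) by exact: u1.
  move=> N; have [|v [hv vS]] :=
    @negligible_bigcup (fun m => [set S | (M0 <= m)%N /\ K S /\ S m]) N _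
      e u' e0 u'1 eu'.
    move=> m _; have [M0m|mM0] := leqP M0 m.
      have -> : [set S | true /\ K S /\ S m] = [set S | K S /\ S m].
        by apply/seteqP; split=> S /=; [case|split].
      exact: nK.
    have -> : [set S : set nat | false /\ K S /\ S m] = set0.
      by apply/seteqP; split=> S // -[].
    move=> d' v d'0 v1 _; exists (v 0); split=> [|S []].
    by split=> // g c; exact.
  exists v; split=> // m S /andP[M0m mN] KS Sm.
  by apply: vS; exists m.
have /choice[bd bdP] := wE_bounded_support.
(* [N l] bounds the supports of all earlier combinations. A set of [K] that one of them charges
   contains a point between [M0] and [N l], so [f (N l)] is small on it. *)
pose N := fix N l := if l is l'.+1 then maxn (N l') (bd (f (N l'))) else 0%N.
have Nmono l l' : (l < l')%N -> (bd (f (N l)) <= N l')%N.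
  elim: l' => // l' IH; rewrite ltnS leq_eqVlt => /predU1P[->|/IH h] /=.
    exact: leq_maxr.
  by rewrite (leq_trans h)// leq_maxl.
pose w l := f (N l).
have w1 l : wprob (w l) by exact: (fP _).1.1.
have wK S l l' : K S -> (l < l')%N -> e < wE (w l) (fun k => ind R (S k)) ->
    wE (w l') (fun k => ind R (S k)) <= e.
  move=> KS ll' large.
  have [m [Sm mM]] : exists m, S m /\ (M0 <= m < bd (w l))%N.
    apply: contrapT => no; have := lt_trans e0 large; apply/negP; rewrite -leNgt.
    have -> : 0 = wE (w l) (fun k => ind R (k < M0)%N) +
        wE (w l) (fun k => ind R (bd (w l) <= k)%N).
      by rewrite bdP addr0; apply/esym/in_hull_eq0; [exact: (fP _).1|].
    rewrite -wED; apply: ler_wE => // k.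
    have [Sk|nSk] := pselect (S k); last by rewrite indF// addr_ge0 ?ind_ge0.
    have [kM|Mk] := ltnP k M0; first by rewrite indT// indT// lerDl ind_ge0.
    rewrite indT// addrC indT ?lerDl ?ind_ge0//.
    by rewrite leqNgt; apply/negP => kb; apply: no; exists k; rewrite Mk.
  apply: (fP _).2 KS Sm; case/andP: mM => -> /= mb.
  exact: leq_trans mb (Nmono _ _ ll').
(* [n] exceeds [1 / e], so the single large term adds at most [1 / n <= e] to the average, and the
   [e]-bounds add at most [e] more. *)
pose n := (Num.truncn e^-1).+1.
have ne : n%:R^-1 <= e.
  by rewrite invf_ple ?posrE// ltW// Num.Theory.truncnS_gt.
exists (wbind (wunif R n) w); split.
  apply: (@in_hull_shift _ _ m0); apply: (@in_hull_trans _ w).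
    by move=> l; exact: (fP _).1.
  by apply: in_hull_bind => //; exact: wprob_unif.
move=> S KS; rewrite wE_bind wE_unif.
rewrite (@le_trans _ _ (n%:R^-1 * (1 + n%:R * e)))//.
  rewrite ler_pM2l ?invr_gt0//; apply: sum_almost_small; first exact: ltW.
    move=> l; rewrite -[leRHS](wE_const 1 (w1 l)); apply: ler_wE => // k.
    exact: ind_le1.
  by move=> l l'; exact: wK.
rewrite mulrDr mulr1 mulKf ?pnatr_eq0//.
by rewrite (le_trans (lerD ne (lexx _)))// /e -splitr.
Qed.

(** If [K] were negligible, the Dirac masses would have a convex combination violating the
    hypothesis. Contraposing [negligible_step], a non-negligible family remains so when a suitable
    further index is required to lie in its members. Iterating yields the indices, and a
    non-negligible family is nonempty. *)
Lemma ptak_lemma K (d : R) : 0 < d ->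
    (forall v, wprob v -> exists2 S, K S & d <= wE v (fun k => ind R (S k))) ->
  exists2 i : nat -> nat, (forall n, (i n < i n.+1)%N) &
    forall n, exists2 S, K S & forall l, (l < n)%N -> S (i l).
Proof.
move=> d0 Kd.
have bad : ~ negligible_family K.
  move=> nK; have [|||v [[v1 _] vK]] := nK (d / 2) (@wdirac R nat).
  - by rewrite divr_gt0.
  - exact: wprob_dirac.
  - by move=> N; exists N => l Nl; rewrite wE_dirac indF// ltnNge Nl.
  - have [S /vK vS Sd] := Kd v v1.
    by have := le_trans Sd vS; apply/negP; rewrite -ltNge gtr_pMr// invf_lt1 ?ltr1n.
have step (s : seq nat) :
    ~ negligible_family [set S | K S /\ forall k, k \in s -> S k] ->
    exists m, (last 0%N s < m)%N /\
      ~ negligible_family [set S | K S /\ forall k, k \in rcons s m -> S k].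
  move=> nS; apply: contrapT => no; apply: nS.
  apply: (@negligible_step _ (last 0%N s).+1) => m sm.
  apply: contrapT => nm; apply: no; exists m; split=> //.
  suff -> : [set S | K S /\ forall k, k \in rcons s m -> S k] =
    [set S | [set S | K S /\ forall k, k \in s -> S k] S /\ S m] by [].
  apply/seteqP; split=> S /=.
    move=> [KS h]; split; last by apply: h; rewrite mem_rcons mem_head.
    by split=> // k ks; apply: h; rewrite mem_rcons inE ks orbT.
  move=> [[KS h] Sm]; split=> // k; rewrite mem_rcons inE => /predU1P[->//|].
  exact: h.
(* The value of [g] at a list whose family is negligible is arbitrary; [sbad] shows that no such
   list occurs in [s]. *)
have /choice[g gP] : forall s : seq nat, exists m : nat,
    ~ negligible_family [set S | K S /\ forall k, k \in s -> S k] ->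
    (last 0%N s < m)%N /\
      ~ negligible_family [set S | K S /\ forall k, k \in rcons s m -> S k].
  move=> s; have [/step[m mP]|h] := pselect
    (~ negligible_family [set S | K S /\ forall k, k \in s -> S k]).
    by exists m.
  by exists 0%N.
pose s := fix s n := if n is n'.+1 then rcons (s n') (g (s n')) else [::].
have sbad n : ~ negligible_family [set S | K S /\ forall k, k \in s n -> S k].
  elim: n => [|n IH]; last exact: (gP _ IH).2.
  suff -> : [set S | K S /\ forall k, k \in s 0 -> S k] = K by [].
  by apply/seteqP; split=> S /=; [case|].
exists (fun n => g (s n)) => [n|n].
  by have [+ _] := gP _ (sbad n.+1); rewrite /= last_rcons.
have [S [KS hS]] : [set S | K S /\ forall k, k \in s n -> S k] !=set0.
  apply/set0P/negP => /eqP E; apply: (sbad n); rewrite E.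
  move=> d' v d'0 v1 _; exists (v 0); split=> [|S []].
  by split=> // h c; exact.
exists S => // l ln; apply: hS.
elim: n ln {KS} => // n IH; rewrite ltnS leq_eqVlt => /predU1P[->|/IH h] /=;
  by rewrite mem_rcons inE ?eqxx ?h ?orbT.
Qed.

End convex_means.

(** Truncating [N] times a weight loses less than one copy of its point, and [g] is at most 1, so
    each entry of [w] costs at most 1. *)
Lemma wE_truncn (R : realType) S (w : seq (R * S)) (N : nat) (g : S -> R) :
    (forall x, List.In x w -> 0 <= x.1) -> (forall s, 0 <= g s <= 1) ->
  0 <= N%:R * wE w g -
    \sum_(s <- flatten [seq nseq (Num.truncn (N%:R * x.1)) x.2 | x <- w]) g s
    <= (size w)%:R.
Proof.
move=> + g01; elim: w => [|x w IH] w0.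
  by rewrite /wE !big_nil mulr0 subr0 lexx.
have /IH/andP[h1 h2] : forall x, List.In x w -> 0 <= x.1.
  by move=> y wy; apply: w0; right.
have x0 : 0 <= x.1 by apply: w0; left.
have /andP[g0 g1] := g01 x.2.
have Nx : 0 <= N%:R * x.1 by rewrite mulr_ge0.
have /andP[t1 t2] := Num.Theory.truncn_itv Nx.
rewrite /wE big_cons -/(wE w g) /= big_cat /= big_nseq iter_addr_0 -[g x.2 *+ _]mulr_natr.
rewrite -natr1 in t2; rewrite -natr1.
set t := (Num.truncn _)%:R in t1 t2 *; set r := (\sum_(j <- _) _) in h1 h2 *.
have E : N%:R * (x.1 * g x.2 + wE w g) - (g x.2 * t + r) =
    (N%:R * x.1 - t) * g x.2 + (N%:R * wE w g - r) by ring.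
rewrite E; apply/andP; split; first by rewrite addr_ge0// mulr_ge0// subr_ge0.
rewrite addrC lerD// -[leRHS]mulr1 ler_pM//.
  by rewrite subr_ge0.
by rewrite lerBlDl ltW.
Qed.

(** The tuple must not depend on [g], as it will serve all instances [phi(x,b)] at once. It repeats
    each point about [n.+1] times its weight. *)
Lemma wE_rounding (R : realType) S (w : seq (R * S)) (e : R) : wprob w ->
  0 < e -> exists n (a : 'I_n.+1 -> S), forall g : S -> R,
    (forall s, 0 <= g s <= 1) ->
    `|wE w g - n.+1%:R^-1 * \sum_(i < n.+1) g (a i)| < e.
Proof.
move=> [w0 w1] e0.
have [s0] : inhabited S.
  case: w w1 {w0} => [|x w _]; last exact: (inhabits x.2).
  by rewrite /wE big_nil => /esym/eqP; rewrite oner_eq0.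
pose n := Num.truncn ((size w)%:R / e); exists n.
have ne : (size w)%:R < n.+1%:R * e.
  by rewrite -ltr_pdivrMr// Num.Theory.truncnS_gt.
pose b := flatten [seq nseq (Num.truncn (n.+1%:R * x.1)) x.2 | x <- w].
(* Truncation leaves [n.+1 - size b] free places, filled with an arbitrary point. *)
pose a := b ++ nseq (n.+1 - size b) s0.
have sum1 : \sum_(s <- b) (1 : R) = (size b)%:R.
  by rewrite big_const_seq count_predT iter_addr_0.
have /andP[b1 b2] : 0 <= (n.+1%:R : R) - (size b)%:R <= (size w)%:R.
  have := @wE_truncn R S w n.+1 (fun=> 1) w0; rewrite w1 mulr1 -sum1.
  by apply => s; rewrite ler01 lexx.
have bn : (size b <= n.+1)%N by rewrite -(ler_nat R) -subr_ge0.
have sa : size a = n.+1 by rewrite size_cat size_nseq subnKC.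
exists (fun i => nth s0 a i) => g g01.
have /andP[h1 h2] := wE_truncn n.+1 w0 g01.
have /andP[g0 g1] := g01 s0.
have -> : \sum_(i < n.+1) g (nth s0 a i) = \sum_(s <- a) g s.
  by rewrite (big_nth s0) sa big_mkord.
rewrite big_cat /= big_nseq iter_addr_0 -[g s0 *+ _]mulr_natr natrB//.
set r := (\sum_(j <- b) _); rewrite -/b -/r in h1 h2.
set c := g s0 * _.
have -> : wE w g - n.+1%:R^-1 * (r + c) =
    n.+1%:R^-1 * ((n.+1%:R * wE w g - r) - c).
  by rewrite !mulrBr mulKf ?pnatr_eq0// mulrDr opprD addrA.
rewrite normrM gtr0_norm ?invr_gt0// ltr_pdivrMl//.
apply: le_lt_trans ne.
(* The truncation error and the padding [c] both lie between 0 and [size w] and have opposite signs,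
   so together they still cost at most [size w]. *)
have h3 : 0 <= c by rewrite mulr_ge0.
have h4 : c <= (size w)%:R by rewrite -[leRHS]mul1r ler_pM.
rewrite ler_norml; lra.
Qed.

(** * Finitely additive probabilities on definable sets *)

(** Finitely additive probabilities on the definable subsets of a set [S] of
  points, each point [s] being an assignment [e s] of the variables. *)
Definition fin_additive (R : realType) L (U : structure L) (V S : Type)
    (e : S -> V -> U) (nu : formula L V -> R) : Prop :=
  [/\ forall p, 0 <= nu p,
      forall p q, (forall s, sat p (e s) <-> sat q (e s)) -> nu p = nu q,
      nu Ftop = 1
    & forall p q, (forall s, ~ (sat p (e s) /\ sat q (e s))) ->
        nu (Fdisj p q) = nu p + nu q].

Section fin_additive_theory.
Variables (R : realType) (L : language) (U : structure L) (V S : Type).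
Variables (e : S -> V -> U) (nu : formula L V -> R).
Hypothesis fa_nu : fin_additive e nu.

Lemma fa_eq p q : (forall s, sat p (e s) <-> sat q (e s)) -> nu p = nu q.
Proof. by case: fa_nu => _ h _ _; exact: h. Qed.

Lemma fa_disj p q : (forall s, ~ (sat p (e s) /\ sat q (e s))) ->
  nu (Fdisj p q) = nu p + nu q.
Proof. by case: fa_nu => _ _ _ h; exact: h. Qed.

Lemma fa_ge0 p : 0 <= nu p.
Proof. by case: fa_nu. Qed.

Lemma fa_top p : (forall s, sat p (e s)) -> nu p = 1.
Proof.
case: fa_nu => _ eqnu nu1 _ h; rewrite -nu1; apply: eqnu => s.
by split=> // _; exact.
Qed.

Lemma fa_bot p : (forall s, ~ sat p (e s)) -> nu p = 0.
Proof.
move=> h; have H : nu (Fdisj p p) = nu p + nu p by apply: fa_disj => s [/h].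
have E : nu (Fdisj p p) = nu p.
  by apply: fa_eq => s; rewrite sat_disj; tauto.
by move: H; rewrite E -[LHS]addr0 => /addrI ->.
Qed.

Lemma fa_split p q : nu p = nu (Fconj p q) + nu (Fconj p (Fneg q)).
Proof.
rewrite -fa_disj => [|s]; last by rewrite !sat_conj sat_neg; tauto.
apply: fa_eq => s; rewrite sat_disj !sat_conj sat_neg.
have := EM (sat q (e s)); tauto.
Qed.

Lemma fa_neg p : nu (Fneg p) = 1 - nu p.
Proof.
have <- : nu Ftop = 1 by case: fa_nu.
rewrite (fa_split Ftop p) (@fa_eq (Fconj Ftop p) p); last first.
  by move=> s; rewrite sat_conj; split=> [[]|h]//; split=> // -[].
rewrite (@fa_eq (Fconj Ftop (Fneg p)) (Fneg p)); last first.
  by move=> s; rewrite sat_conj; split=> [[]|h]//; split=> // -[].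
by rewrite addrAC subrr add0r.
Qed.

Lemma fa_le1 p : nu p <= 1.
Proof. by rewrite -subr_ge0 -fa_neg fa_ge0. Qed.

Lemma fa_le p q : (forall s, sat p (e s) -> sat q (e s)) -> nu p <= nu q.
Proof.
move=> pq; rewrite (fa_split q p) (@fa_eq (Fconj q p) p) ?lerDl ?fa_ge0// => s.
by rewrite sat_conj; split=> [[]//|h]; split=> //; exact: pq.
Qed.

(** The induction cuts [chi] along each formula of the list, so that the points of a cell decide
    that formula. A final cell carries its mass at a single point; an empty one has measure 0 and
    receives none. *)
Let fa_points_in (F : seq (formula L V)) chi : exists w : seq (R * S),
  [/\ forall x, List.In x w -> 0 <= x.1,
      wE w (fun=> 1) = nu chi,
      forall x, List.In x w -> sat chi (e x.2)
    & forall f, List.In f F ->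
        wE w (fun s => ind R (sat f (e s))) = nu (Fconj chi f)].
Proof.
elim: F chi => [|f F IH] chi.
  have [[s hs]|no] := pselect (exists s, sat chi (e s)).
    exists [:: (nu chi, s)]; split=> // [x [<-|//]||x [<-|//]//].
      exact: fa_ge0.
    by rewrite wE_cons wE_nil addr0 mulr1.
  exists [::]; split=> //; rewrite wE_nil fa_bot// => s hs.
  by apply: no; exists s.
have [w [w0 w1 ws wF]] := IH (Fconj chi f).
have [w' [w'0 w'1 w's w'F]] := IH (Fconj chi (Fneg f)).
exists (w ++ w'); split.
- by move=> x /List.in_app_iff[]; [exact: w0|exact: w'0].
- by rewrite wE_cat w1 w'1 -fa_split.
- by move=> x /List.in_app_iff[/ws|/w's] /sat_conj[].
- move=> g [<-|gF].
    rewrite wE_cat -[RHS]addr0 -w1; congr (_ + _).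
      elim: w ws {w0 w1 wF} => [|x w IHw] ws; first by rewrite !wE_nil.
      rewrite !wE_cons; congr (_ * _ + _); last first.
        by apply: IHw => y wy; apply: ws; right.
      by rewrite indT//; have /sat_conj[] := ws x (or_introl erefl).
    elim: w' w's {w'0 w'1 w'F} => [|x w' IHw] w's; first exact: wE_nil.
    rewrite wE_cons IHw ?addr0.
      have /sat_conj[_ nf] := w's x (or_introl erefl).
      by rewrite indF ?mulr0.
    by move=> y wy; apply: w's; right.
  rewrite wE_cat wF// w'F// (fa_split (Fconj chi g) f).
  congr (_ + _); apply: fa_eq => s; rewrite !sat_conj ?sat_neg; tauto.
Qed.

Lemma fa_points (F : seq (formula L V)) : exists2 w : seq (R * S), wprob w &
  forall f, List.In f F -> wE w (fun s => ind R (sat f (e s))) = nu f.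
Proof.
have [w [w0 w1 _ wF]] := fa_points_in F Ftop.
exists w; first by split=> //; rewrite w1; apply: fa_top => s [].
by move=> f /wF ->; apply: fa_eq => s; rewrite sat_conj; split=> [[]|h]//; split=> // -[].
Qed.

(** A formula true at all the new points is true at all the old ones, by the hypothesis applied to
    its negation. Equivalence and disjointness are such statements. This is how points of [U] are
    exchanged for points of [M]. *)
Lemma fa_restrict (S' : Type) (e' : S' -> V -> U) :
    (forall p, (exists s, sat p (e s)) -> exists s, sat p (e' s)) ->
  fin_additive e' nu.
Proof.
move=> ee'.
have imp p : (forall s, sat p (e' s)) -> forall s, sat p (e s).
  move=> h s; apply: contrapT => ns.
  by have [|s' /(_ (h s'))] := ee' (Fneg p); first by exists s.
case: fa_nu => nu0 _ nu1 _; split=> // p q pq.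
  apply: fa_eq => s; split=> hs.
    by apply: (imp (Fimp p q)) hs => s' /= /pq.
  by apply: (imp (Fimp q p)) hs => s' /= /pq.
apply: fa_disj => s [hp hq]; apply: (imp (Fimp p (Fneg q))) hp hq => s' /=.
by move=> hp hq; apply: (pq s').
Qed.

End fin_additive_theory.

Section discrete_fin_additive.
Variables (R : realType) (L : language) (U : structure L) (V S : Type).
Variables (e : S -> V -> U).

Lemma fin_additive_wE (w : seq (R * S)) : wprob w ->
  fin_additive e (fun p => wE w (fun s => ind R (sat p (e s)))).
Proof.
move=> w1; split.
- by move=> p; apply: wE_ge0 => [|s]; [case: w1|exact: ind_ge0].
- by move=> p q pq; apply: eq_wE => s; exact: eq_ind.
- rewrite -[RHS](wE_const 1 w1); apply: eq_wE => s; rewrite indT//.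
- move=> p q pq; rewrite -wED; apply: eq_wE => s.
  rewrite (eq_ind _ (sat_disj _ _ _)).
  have [hp|np] := pselect (sat p (e s)).
    rewrite indT; last by left.
    by rewrite indT// indF ?addr0// => hq; apply: (pq s).
  rewrite [X in _ = X + _]indF// add0r; apply: eq_ind.
  by split=> [[]//|]; right.
Qed.

End discrete_fin_additive.

(** * Ultralimits and extension of finitely additive probabilities *)

Section ultralimits.
Variables (R : realType) (I : Type) (V : set_system I).
Hypothesis VU : UltraFilter V.

Definition ulim (g : I -> R) : R := lim (g x @[x --> V]).

Lemma cvg_ulim g : (forall i, 0 <= g i <= 1) -> g x @[x --> V] --> ulim g.
Proof.
move=> g01.
have [PV _] := VU.
suff : cvg (g x @[x --> V]) by [].
have [|y [_ cl]] := @segment_compact R 0 1 (g @ V) (fmap_proper_filter g PV).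
  by apply: nearW => i; rewrite /= in_itv /=.
apply/cvg_ex; exists y => A Ay.
have [//|VA] := in_ultra_setVsetC (g @^-1` A) VU.
have [z [nAz Az]] : (~` A) `&` A !=set0 by apply: cl.
by case: (nAz Az).
Qed.

Lemma ulim_cvg g l : g x @[x --> V] --> l -> ulim g = l.
Proof.
have [PV _] := VU.
by move=> gl; apply: cvg_lim gl.
Qed.

Lemma ulim_near_eq g l : (\forall i \near V, g i = l) -> ulim g = l.
Proof.
have [PV _] := VU.
by move=> gl; apply: ulim_cvg; apply: cvg_near_cst.
Qed.

(** Additivity is only required eventually, since the points at which the
  formulas are disjoint are those of the limit. *)
Lemma fin_additive_ulim L (U : structure L) (W S : Type) (e : S -> W -> U)
    (nu : I -> formula L W -> R) :
    (forall i p, 0 <= nu i p <= 1) ->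
    (forall i, nu i Ftop = 1) ->
    (forall p q, (forall s, sat p (e s) <-> sat q (e s)) ->
      \forall i \near V, nu i p = nu i q) ->
    (forall p q, (forall s, ~ (sat p (e s) /\ sat q (e s))) ->
      \forall i \near V, nu i (Fdisj p q) = nu i p + nu i q) ->
  fin_additive e (fun p => ulim (nu^~ p)).
Proof.
move=> nu01 nu1 nueq nuD.
have [PV _] := VU.
have nuc p : nu i p @[i --> V] --> ulim (nu^~ p) by exact: cvg_ulim.
split.
- move=> p; apply: (cvgr_to_ge (nuc p)); apply: nearW => i.
  by have /andP[] := nu01 i p.
- move=> p q /nueq pq; apply: ulim_cvg; apply: cvg_trans (nuc q).
  by apply: near_eq_cvg; near=> i; apply/esym; near: i.
- by apply: ulim_near_eq; apply: nearW.
- move=> p q /nuD pq; apply: ulim_cvg; apply: cvg_trans (cvgD (nuc p) (nuc q)).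
  by apply: near_eq_cvg; near=> i; apply/esym; near: i.
Unshelve. all: by end_near.
Qed.

End ultralimits.

Lemma ultrafilter_base (I T : Type) (B : I -> set T) (i0 : I) :
    (forall i j, exists k, B k `<=` B i `&` B j) ->
    (forall i, B i !=set0) ->
  exists V : set_system T, UltraFilter V /\ forall i, V (B i).
Proof.
move=> BI B0.
have FF : Filter (filter_from [set: I] B).
  by apply: filter_fromT_filter => //; exists i0.
have PF : ProperFilter (filter_from [set: I] B).
  by apply: filter_from_proper => // i _.
have [V [VU BV]] := ultraFilterLemma PF.
by exists V; split=> // i; apply: BV; exists i.
Qed.

(** Lists under inclusion play the role of finite subsets. *)
Lemma ultrafilter_seq T : exists V : set_system (seq T), UltraFilter V /\
  forall f, V [set F | List.In f F].
Proof.
have [|G|V [VU BV]] := @ultrafilter_base (seq T) (seq T)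
  (fun G => [set F | List.incl G F]) [::].
- move=> G G'; exists (G ++ G') => F GF.
  by split=> x xG; apply: GF; apply/List.in_app_iff; [left|right].
- by exists G => x.
- exists V; split=> // f.
  have [VF _] := VU.
  by apply: filterS (BV [:: f]) => F; apply; left.
Qed.

(** Any finite list of values of [nu] is attained exactly by weighted points of [S], and these also
    measure the formulas in [W]. The extension is their ultralimit over all lists. *)
Lemma fin_additive_extension (R : realType) L (U : structure L) (V W S : Type)
    (e : S -> V -> U) (e' : S -> W -> U) (t : formula L V -> formula L W)
    (nu : formula L V -> R) :
    (forall p s, sat (t p) (e' s) <-> sat p (e s)) ->
    fin_additive e nu ->
  exists nu' : formula L W -> R, fin_additive e' nu' /\
    forall p, nu' (t p) = nu p.
Proof.
move=> te fnu.
have /choice[w wP] : forall F : seq (formula L V), exists w : seq (R * S),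
    wprob w /\
    forall f, List.In f F -> wE w (fun s => ind R (sat f (e s))) = nu f.
  by move=> F; have [w w1 wF] := fa_points fnu F; exists w.
have [D [DU DF]] := ultrafilter_seq (formula L V).
have [PD _] := DU.
pose nu_ F p := wE (w F) (fun s => ind R (sat p (e' s))).
have fnu_ F : fin_additive e' (nu_ F) by exact: fin_additive_wE (wP F).1.
exists (fun p => ulim D (nu_^~ p)); split.
  apply: (fin_additive_ulim DU).
  - by move=> F p; rewrite (fa_ge0 (fnu_ F)) (fa_le1 (fnu_ F)).
  - by move=> F; rewrite (fa_top (fnu_ F))// => s; case.
  - by move=> p q pq; apply: nearW => F; exact: fa_eq (fnu_ F) _ _ pq.
  - by move=> p q pq; apply: nearW => F; exact: fa_disj (fnu_ F) _ _ pq.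
move=> p; apply: ulim_near_eq; apply: filterS (DF p) => F pF.
by rewrite -((wP F).2 p pF); apply: eq_wE => s; apply: eq_ind; exact: te.
Qed.

(** * Realization of types *)

Lemma holds_toU L (U : structure L) (A : set U) (Y : Type)
    (f : formula L (Y + A)) (b : Y -> U) :
  holds (toU f) b <-> sat f (sum_case b set_val).
Proof. by rewrite /holds /toU sat_frename sum_case_comp. Qed.

Lemma small_setU1 (K T : Type) (A : set T) (a : T) :
  small K [set: nat] -> small K A -> small K (a |` A).
Proof.
move=> Knat KA; apply/negP => KaA.
have [finA|/infiniteP/card_leP[g]] := pselect (finite_set A).
  move/negP: Knat; apply; apply: card_le_trans KaA _.
  by apply: finite_set_countable; rewrite finite_setU; split=> //.
pose h n := set_val (g (exist _ n (mem_set I))).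
have hA n : A (h n) by exact: set_valP.
have hinj : injective h.
  move=> m n /val_inj /(@inj _ _ _ g) E.
  by have /(congr1 val) := E (mem_set I) (mem_set I).
(* A backward shift along the sequence [h] in [A]: [h 0] goes to [a] and [h n.+1] to [h n], so [A]
   is mapped onto [A] with [a] added. *)
pose k x := match pselect (exists n, x = h n) with
  | left e => if sval (cid e) is n.+1 then h n else a
  | right _ => x end.
move/negP: KA; apply; apply: card_le_trans KaA _.
apply: card_le_trans (card_image_le k A); apply: subset_card_le.
have kh n : k (h n) = if n is n'.+1 then h n' else a.
  rewrite /k; case: pselect => [e|]; last by case; exists n.
  by case: cid => /= m /hinj <-.
move=> x [->|Ax]; first by exists (h 0%N) => //; rewrite kh.
have [[n ->]|no] := pselect (exists n, x = h n).
  by exists (h n.+1) => //; rewrite kh.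
by exists x => //; rewrite /k; case: pselect.
Qed.

Lemma small_setU_finite (K T : Type) (A B : set T) : finite_set B ->
  small K [set: nat] -> small K A -> small K (B `|` A).
Proof.
move=> finB Knat KA; have [s ->] := (@finite_seqP {classic T} B).1 finB.
rewrite -[X in X `|` A]/([set x | x \in s]); elim: s => [|x s IH].
  suff -> : (fun x : {classic T} => x \in [::]) `|` A = A by [].
  by apply/seteqP; split=> y //=; [case|right].
suff -> : (fun y : {classic T} => y \in x :: s) `|` A =
  x |` ((fun y : {classic T} => y \in s) `|` A) by exact: small_setU1.
apply/seteqP; split=> y /=; rewrite inE.
  by move=> [/predU1P[->|ys]|Ay]; [left|right; left|right; right].
by move=> [->|[->|Ay]]; rewrite ?eqxx ?orbT; [left|left|right].
Qed.

Definition Fconjs L (V : Type) (s : seq (formula L V)) : formula L V :=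
  foldr (@Fconj L V) Ftop s.

Lemma sat_conjs L (U : structure L) (V : Type) (s : seq (formula L V))
    (v : V -> U) :
  sat (Fconjs s) v <-> forall f, List.In f s -> sat f v.
Proof.
elim: s => [|f s IH]; first by split=> // _ [].
rewrite [Fconjs _]/= sat_conj IH; split=> [[hf hs] g [<-|/hs]//|h].
by split=> [|g gs]; apply: h; [left|right].
Qed.

Lemma finite_set_list T (F : set T) : finite_set F ->
  exists s : seq T, forall x, F x <-> List.In x s.
Proof.
move=> finF; have [s ->] := (@finite_seqP {classic T} F).1 finF.
exists s => x /=; elim: s => //= y s IH.
rewrite inE; split=> [/predU1P[->|/IH]|[->|/IH h]]; [by left|by right| |].
  by rewrite eqxx.
by rewrite h orbT.
Qed.

Definition ocons n T (c : T) (b : 'I_n -> T) (i : 'I_n.+1) : T :=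
  if unlift ord0 i is Some j then b j else c.

Section realization.
Variables (L : language) (U : structure L) (K : Type).
Hypothesis monsterU : monster K U.

(** Saturation is given for one variable. The last [n] coordinates are found first, by realizing the
    formulas which say that a finite part of [p] has a solution in the first coordinate. Their
    values then become parameters, and saturation supplies the first coordinate. *)
Let realize_ord n (A : set U) (p : set (formula L ('I_n + A))) : small K A ->
  finitely_satisfiable p -> exists b : 'I_n -> U, forall f, p f -> holds (toU f) b.
Proof.
have [Knat _ sat1 _] := monsterU.
elim: n A p => [|n IH] A p KA pfs.
  have [x] := dom_nonempty U.
  exists (fun=> x) => f pf; have [||a /(_ f erefl)] := pfs [set f].
  - exact: finite_set1.
  - by move=> _ ->.
  - by congr (holds _ _); apply/funext => -[].
pose s (z : 'I_n.+1 + A) : option ('I_n + A) :=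
  match z with
  | inl i => omap inl (unlift ord0 i)
  | inr a => Some (inr a)
  end.
have sE (b : 'I_n -> U) (c : U) :
    oapp (sum_case b (set_val : A -> U)) c \o s = sum_case (ocons c b) set_val.
  by apply/funext => -[i|a] //=; rewrite /ocons; case: unlift.
pose p1 := [set g : formula L ('I_n + A) | exists2 F,
  finite_set F /\ F `<=` p & forall b, holds (toU g) b <->
    exists c, forall f, F f -> holds (toU f) (ocons c b)].
have p1E F : finite_set F -> F `<=` p -> exists2 g, p1 g &
    forall b, holds (toU g) b <->
    exists c, forall f, F f -> holds (toU f) (ocons c b).
  move=> finF Fp; have [l lE] := finite_set_list finF.
  have gE b : holds (toU (Fex (frename s (Fconjs l)))) b <->
      exists c, forall f, F f -> holds (toU f) (ocons c b).
    rewrite holds_toU sat_ex.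
    split=> -[c h]; exists c.
      move: h; rewrite sat_frename sE sat_conjs => h f /lE /h.
      by rewrite holds_toU.
    by rewrite sat_frename sE sat_conjs => f /lE /h; rewrite holds_toU.
  by exists (Fex (frename s (Fconjs l))) => //; exists F.
have [|b bp1] := IH A p1 KA.
  move=> G finG Gp1.
  have /choice[F FP] : forall g, exists F, G g -> (finite_set F /\ F `<=` p) /\
      forall b, holds (toU g) b <->
      exists c, forall f, F f -> holds (toU f) (ocons c b).
    move=> g; have [Gg|nG] := pselect (G g); last by exists set0.
    by have [F F1 F2] := Gp1 g Gg; exists F.
  have [||a aP] := pfs (\bigcup_(g in G) F g).
  - by apply: bigcup_finite => // g /FP[[]].
  - by move=> f [g /FP[[_ h] _] /h].
  - exists (a \o lift ord0) => g Gg; apply/(FP g Gg).2; exists (a ord0) => f Ff.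
    have -> : ocons (a ord0) (a \o lift ord0) = a.
      apply/funext => i; rewrite /ocons.
      by case: unliftP => [j ->|->].
    by apply: aP; exists g.
have KA' : small K (range b `|` A).
  apply: small_setU_finite => //.
  exact: finite_image.
pose inA' (a : A) : range b `|` A :=
  exist _ (set_val a) (mem_set (or_intror (set_valP a))).
pose inb' (j : 'I_n) : range b `|` A :=
  exist _ (b j) (mem_set (or_introl (ex_intro2 _ _ j I erefl))).
pose t (z : 'I_n.+1 + A) : unit + (range b `|` A) :=
  match z with
  | inl i => if unlift ord0 i is Some j then inr (inb' j) else inl tt
  | inr a => inr (inA' a)
  end.
have tE (f : formula L ('I_n.+1 + A)) (c : unit -> U) :
    holds (toU (frename t f)) c <-> holds (toU f) (ocons (c tt) b).
  rewrite !holds_toU sat_frename.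
  suff -> : sum_case c set_val \o t = sum_case (ocons (c tt) b) set_val by [].
  by apply/funext => -[i|a] //=; rewrite /ocons; case: unlift.
have [|c cP] := sat1 _ KA' [set frename t f | f in p].
- move=> G finG Gp.
  have /choice[F FP] : forall g, exists f, G g -> p f /\ frename t f = g.
    move=> g; have [Gg|nG] := pselect (G g); last by exists Fbot.
    by have [f pf fg] := Gp g Gg; exists f.
  have [||g p1g gE] := p1E (F @` G).
  - exact: finite_image.
  - by move=> _ [g /FP[pf _] <-].
  - have /gE[c cF] := bp1 g p1g; exists (fun=> c) => h Gh.
    rewrite -(FP h Gh).2 tE; apply: cF; by exists h.
- exists (ocons (c tt) b) => f pf; apply/tE.
  by apply: cP; exists f.
Qed.

Lemma realize_finitely_satisfiable (Y : finType) (A : set U)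
    (p : set (formula L (Y + A))) : small K A ->
  finitely_satisfiable p -> exists b : Y -> U, forall f, p f -> holds (toU f) b.
Proof.
move=> KA pfs.
pose r : Y + A -> 'I_#|Y| + A := sum_map enum_rank id.
have rE f (b : 'I_#|Y| -> U) :
    holds (toU (frename r f)) b <-> holds (toU f) (b \o enum_rank).
  by rewrite !holds_toU sat_frename sum_case_comp.
have [|b bP] := @realize_ord _ A [set frename r f | f in p] KA.
  move=> G finG Gp.
  have /choice[F FP] : forall g, exists f, G g -> p f /\ frename r f = g.
    move=> g; have [Gg|nG] := pselect (G g); last by exists Fbot.
    by have [f pf fg] := Gp g Gg; exists f.
  have [||a aP] := pfs (F @` G).
  - exact: finite_image.
  - by move=> _ [g /FP[pf _] <-].
  - exists (a \o enum_val) => g Gg; rewrite -(FP g Gg).2 rE.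
    have -> : (a \o enum_val) \o enum_rank = a.
      by apply/funext => y /=; rewrite enum_rankK.
    by apply: aP; exists g.
exists (b \o enum_rank) => f pf; apply/rE.
by apply: bP; exists f.
Qed.

Lemma realize_type (Y : finType) (A : set U) (q : types A Y) : small K A ->
  exists b : Y -> U, realizes b q.
Proof.
by move=> KA; have [pfs _] := svalP q; exact: realize_finitely_satisfiable.
Qed.

End realization.

(** * Type spaces *)

Section type_spaces.
Variables (L : language) (U : structure L) (A : set U) (Y : Type).
Implicit Types (q : types A Y) (f g : formula L (Y + A)).

(** Finitely many formulas cannot tell a type from a point, so propositional laws for types can be
    checked at points of [U]. *)
Lemma type_point q (s : seq (formula L (Y + A))) :
  exists b : Y -> U, forall f, List.In f s -> sval q f <-> holds (toU f) b.
Proof.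
case: q => p [fs cp] /=.
pose t f := if pselect (p f) then f else Fneg f.
have tp f : p (t f) by rewrite /t; case: pselect => // np; case: (cp f).
have [||b bP] := fs [set g | List.In g (map t s)].
- elim: s => [|g s IH]; first by rewrite (_ : mkset _ = set0)//; exact/seteqP.
  rewrite (_ : mkset _ = t g |` [set h | List.In h (map t s)]).
    by rewrite finite_setU; split=> //; exact: finite_set1.
  by apply/seteqP; split=> h [->|]; [left|right|left|right].
- by move=> g /List.in_map_iff[h [<- _]].
- exists b => f fs'; have /bP : [set g | List.In g (map t s)] (t f).
    exact: List.in_map.
  rewrite /t; case: pselect => // np h; split=> // hf; exfalso.
  exact: h.
Qed.

Lemma type_neg q f : sval q (Fneg f) <-> ~ sval q f.
Proof.
have [b bP] := type_point q [:: f; Fneg f].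
by rewrite (bP f) ?(bP (Fneg f))//=; [right; left|left].
Qed.

Lemma type_disj q f g : sval q (Fdisj f g) <-> sval q f \/ sval q g.
Proof.
have [b bP] := type_point q [:: f; g; Fdisj f g].
rewrite (bP f) ?(bP g) ?(bP (Fdisj f g))/=; [|by auto..].
exact: sat_disj.
Qed.

Definition tp (b : Y -> U) : types A Y := exist _ _ (complete_type_tp A b).

Lemma realizesP (b : Y -> U) q : realizes b q ->
  forall f, sval q f <-> holds (toU f) b.
Proof.
move=> bq f; split; first exact: bq.
by move=> hf; apply: contrapT => /type_neg /bq; apply.
Qed.

Lemma type_eq q q' : (forall f, sval q f -> sval q' f) -> q = q'.
Proof.
move=> qq'; case: q q' qq' => p pP [p' p'P] /= pp'.
have E : p = p'.
  apply/seteqP; split=> // f p'f; apply: contrapT => npf.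
  have [//|/pp' h] := pP.2 f.
  by have /(type_neg (exist _ _ p'P)) := h.
by subst p'; congr exist; exact: Prop_irrelevance.
Qed.

Lemma open_clopen f : open (clopen_of f : set (types A Y)).
Proof. by move=> q qf; exists f. Qed.

Lemma clopen_neg f : clopen_of (Fneg f) = ~` clopen_of f :> set (types A Y).
Proof. by apply/seteqP; split=> q /type_neg. Qed.

Lemma clopen_conj f g :
  clopen_of (Fconj f g) = clopen_of f `&` clopen_of g :> set (types A Y).
Proof. by apply/seteqP; split=> q /complete_type_conj. Qed.

Lemma clopen_disj f g :
  clopen_of (Fdisj f g) = clopen_of f `|` clopen_of g :> set (types A Y).
Proof. by apply/seteqP; split=> q /type_disj. Qed.

Lemma clopen_sub f g : (clopen_of f : set (types A Y)) `<=` clopen_of g ->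
  forall b, holds (toU f) b -> holds (toU g) b.
Proof. by move=> fg b; exact: (fg (tp b)). Qed.

Lemma closed_clopen f : closed (clopen_of f : set (types A Y)).
Proof.
rewrite -[X in closed X]setCK -clopen_neg; apply: open_closedC.
exact: open_clopen.
Qed.

Lemma types_hausdorff : hausdorff_space (types A Y).
Proof.
rewrite open_hausdorff => q q' /eqP qq'.
have [f qf q'f] : exists2 f, sval q f & ~ sval q' f.
  apply: contrapT => no; apply: qq'; apply: type_eq => f qf.
  by apply: contrapT => q'f; apply: no; exists f.
exists (clopen_of f, clopen_of (Fneg f)) => /=.
  by split; apply/mem_set => //; exact/type_neg.
split; [exact: open_clopen|exact: open_clopen|].
by apply/eqP; rewrite clopen_neg setICr.
Qed.

(** An ultrafilter [F] converges to the set of all [f] whose clopen set belongs to [F]: it is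
    complete because [F] is ultra, and finitely satisfiable because [F] is a proper filter. *)
Lemma types_compact : compact [set: types A Y].
Proof.
rewrite compact_ultra => F FU _; have [PF _] := FU.
have ct : complete_type [set f | F (clopen_of f)].
  split=> [G finG GF|f]; last first.
    by rewrite /= clopen_neg; exact: in_ultra_setVsetC.
  have [s sE] := finite_set_list finG.
  have Fs : F [set r | forall f, List.In f s -> sval r f].
    have : forall f, List.In f s -> F (clopen_of f) by move=> f /sE /GF.
    elim: s {sE} => [|f s IH] sF.
      by apply: filterS (@filterT _ F _) => r _ f [].
    have Ff : F (clopen_of f) by apply: sF; left.
    have Fs : F [set r | forall f, List.In f s -> sval r f].
      by apply: IH => g gs; apply: sF; right.
    by apply: filterS (filterI Ff Fs) => r [rf rs] g [<-//|]; exact: rs.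
  have [r rs] := filter_ex Fs; have [b bP] := type_point r s.
  by exists b => f /sE fs; apply/(bP f fs); exact: rs.
exists (exist _ _ ct); split=> // O; rewrite nbhsE => -[B [oB Bq] BO].
have [f Ff fB] := oB _ Bq; apply: filterS Ff => r rf.
by apply: BO; apply: fB.
Qed.

Lemma compact_clopen f : compact (clopen_of f : set (types A Y)).
Proof.
exact: subclosed_compact (@closed_clopen f) types_compact (@subsetT _ _).
Qed.

Lemma compact_open_clopen (C O : set (types A Y)) : compact C -> open O ->
  C `<=` O -> exists2 f, C `<=` clopen_of f & clopen_of f `<=` O.
Proof.
rewrite compact_cover => cC oO CO.
have [||D DO CD] := cC {classic formula L (Y + A)}
  [set f | (clopen_of f : set (types A Y)) `<=` O] (fun f => clopen_of f).
- by move=> f _; exact: open_clopen.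
- by move=> q /CO /oO[f qf fO]; exists f.
have {}CD : forall q, C q -> exists f, f \in (D : seq _) /\ sval q f.
  by move=> q /CD[f fD qf]; exists f.
have {}DO : forall f, f \in (D : seq _) ->
    (clopen_of f : set (types A Y)) `<=` O by move=> f /DO /set_mem.
suff [f fE] : exists f, forall q : types A Y,
    sval q f <-> exists g, g \in (D : seq _) /\ sval q g.
  exists f => q; first by move=> /CD /fE.
  by move=> /fE[g [/DO]]; exact.
elim: (D : seq _) => [|g s [f fE]].
  exists Fbot => q; split=> [|[g []]//].
  have [b bP] := type_point q [:: Fbot].
  by rewrite (bP Fbot); [|left].
exists (Fdisj g f) => q; rewrite type_disj fE; split=> [[qg|[h [hs qh]]]|].
- by exists g; split=> //; exact: mem_head.
- by exists h; split=> //; apply/predU1P; right.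
- by move=> [h [/predU1P[->|hs] qh]]; [left|right; exists h].
Qed.

Lemma clopen_bigcup_open f (O : nat -> set (types A Y)) :
    (forall n, open (O n)) -> clopen_of f `<=` \bigcup_n O n ->
  exists N, clopen_of f `<=` \bigcup_(n < N) O n.
Proof.
move=> oO fO; have := @compact_clopen f; rewrite compact_cover => cf.
have [//|//|D _ fD] := cf nat setT O.
exists (\max_(i <- (D : seq nat)) i).+1 => q /fD[n nD Onq]; exists n => //=.
by rewrite ltnS; apply: (@leq_bigmax_seq _ (D : seq nat) xpredT id).
Qed.

End type_spaces.

(** * Regular Borel extensions *)

Lemma measurable_open_types L (U : structure L) (A : set U) (Y : Type)
    (V : set (types A Y)) : open V -> measurable (V : set (borel_types A Y)).
Proof. by move=> oV; exact: sub_sigma_algebra. Qed.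

Lemma measurable_compact_types L (U : structure L) (A : set U) (Y : Type)
    (C : set (types A Y)) : compact C -> measurable (C : set (borel_types A Y)).
Proof.
move=> cC; rewrite -[C]setCK; apply: measurableC; apply: measurable_open_types.
by apply: closed_openC; exact: compact_closed (@types_hausdorff _ _ _ _) cC.
Qed.

(** The type space is compact, so the complement of an open set containing the complement of [B] is
    a compact subset of [B]. Inner regularity at [B] is thus outer regularity at its complement. *)
Lemma outer_regular_measure (R : realType) L (U : structure L) (A : set U)
    (Y : Type) (P : probability (borel_types A Y) R) :
    (forall B, measurable B -> P B = ereal_inf [set P O | O in
       [set O : set (types A Y) | open O /\ B `<=` O]]) ->
  regular_measure P.
Proof.
move=> Pout B mB; split; first exact: Pout.
apply/eqP; rewrite eq_le; apply/andP; split; last first.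
  apply: ge_ereal_sup => _ [C [cC CB] <-]; apply: le_measure => //;
    rewrite inE//; exact: measurable_compact_types.
apply/lee_addgt0Pr => e e0.
have mBC : measurable (~` B) by exact: measurableC.
have finBC : P (~` B) \is a fin_num by exact: fin_num_measure.
have := Pout _ mBC.
have [|_ [V [oV BV] <-] /ltW h] := @lb_ereal_inf_adherent R
    [set P O | O in [set O : set (types A Y) | open O /\ ~` B `<=` O]] e e0.
  by rewrite -Pout.
rewrite -Pout// in h => _.
have mV : measurable (V : set (borel_types A Y)) by exact: measurable_open_types.
apply: (@le_trans _ _ (P (~` V) + e%:E)%E); last first.
  apply: leeD => //; apply: ereal_sup_ubound; exists (~` V) => //; split.
    by apply: subclosed_compact (@types_compact _ _ _ _) _; [exact: open_closedC|].
  by rewrite -[B]setCK; exact: subsetC.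
have finV : P V \is a fin_num by exact: fin_num_measure.
rewrite -[X in (P X <= _)%E]setCK (probability_setC P mBC) (probability_setC P mV).
move: finBC finV h => /fineK <- /fineK <-.
rewrite -!EFinB -!EFinD !lee_fin; lra.
Qed.

Section borel_extension.
Variables (R : realType) (L : language) (U : structure L) (A : set U).
Variables (Y : Type) (nu : formula L (Y + A) -> R).
Hypothesis fnu : fin_additive (fun b : Y -> U => sum_case b set_val) nu.
Local Notation T := (types A Y).
Local Open Scope ereal_scope.

(** Riesz-style construction: open sets are measured from inside by clopen sets, then arbitrary sets
    from outside by open sets, and Caratheodory's criterion yields the Borel measure. *)
Definition clopen_content (O : set T) : \bar R :=
  ereal_sup [set (nu f)%:E | f in [set f | clopen_of f `<=` O]].

Definition clopen_outer (E : set T) : \bar R :=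
  ereal_inf [set clopen_content O | O in [set O : set T | open O /\ E `<=` O]].

Local Notation inner := clopen_content.
Local Notation outer := clopen_outer.

Lemma clopen_nu_le f g : (clopen_of f : set T) `<=` clopen_of g ->
  (nu f <= nu g)%R.
Proof.
move=> fg; apply: (fa_le fnu) => b.
by rewrite -!holds_toU; exact: clopen_sub.
Qed.

Lemma clopen_content_sub f (O : set T) : clopen_of f `<=` O ->
  (nu f)%:E <= inner O.
Proof. by move=> fO; apply: ereal_sup_ubound; exists f. Qed.

Lemma clopen_content_le (O : set T) (c : \bar R) :
  (forall f, clopen_of f `<=` O -> (nu f)%:E <= c) -> inner O <= c.
Proof. by move=> h; apply: ge_ereal_sup => _ [f fO <-]; exact: h. Qed.

Lemma clopen_bot : clopen_of Fbot = set0 :> set T.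
Proof.
apply/seteqP; split=> // q; have [b bP] := type_point q [:: Fbot].
by move=> /(bP Fbot (or_introl erefl)).
Qed.

Lemma nu_bot : (nu Fbot)%:E = 0.
Proof. by congr EFin; apply: (fa_bot fnu) => b. Qed.

Lemma clopen_content_ge0 (O : set T) : 0 <= inner O.
Proof. by rewrite -nu_bot; apply: clopen_content_sub; rewrite clopen_bot. Qed.

Lemma clopen_content_le1 (O : set T) : inner O <= 1.
Proof. by apply: clopen_content_le => f _; rewrite lee_fin (fa_le1 fnu). Qed.

Lemma clopen_content_mono (O O' : set T) : O `<=` O' -> inner O <= inner O'.
Proof.
move=> OO'; apply: clopen_content_le => f fO; apply: clopen_content_sub.
exact: subset_trans OO'.
Qed.

Lemma clopen_content_clopen f : inner (clopen_of f) = (nu f)%:E.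
Proof.
apply/eqP; rewrite eq_le clopen_content_sub// andbT.
by apply: clopen_content_le => g gf; rewrite lee_fin; exact: clopen_nu_le.
Qed.

(** The part outside [O'] of a clopen set covered by [O] and [O'] is a compact subset of [O]. A
    clopen [g] between the two cuts the set into one piece inside [O] and one inside [O']. *)
Lemma clopen_content_setU (O O' : set T) : open O -> open O' ->
  inner (O `|` O') <= inner O + inner O'.
Proof.
move=> oO oO'; apply: clopen_content_le => f fOO'.
have [|||g fg gO] := @compact_open_clopen _ _ _ _ (clopen_of f `&` ~` O') O.
- by apply: compact_closedI; [exact: compact_clopen|exact: open_closedC].
- by [].
- by move=> q [/fOO'[]].
- rewrite (fa_split fnu f g) EFinD; apply: leeD.
    rewrite (@le_trans _ _ (nu g)%:E)//; last exact: clopen_content_sub.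
    by rewrite lee_fin clopen_nu_le// clopen_conj; exact: subIsetr.
  apply: clopen_content_sub; rewrite clopen_conj clopen_neg => q [qf ng].
  by apply: contrapT => nO'; apply: ng; exact: fg.
Qed.

Lemma clopen_content_bigcup (O : nat -> set T) : (forall n, open (O n)) ->
  inner (\bigcup_n O n) <= \sum_(n <oo) inner (O n).
Proof.
move=> oO; apply: clopen_content_le => f /(clopen_bigcup_open oO)[N fN].
apply: le_trans (nneseries_lim_ge N _); last first.
  by move=> n _ _; exact: clopen_content_ge0.
apply: le_trans (clopen_content_sub fN) _; rewrite bigcup_mkord big_mkord.
elim: N {fN} => [|N IH].
  by rewrite !big_ord0 -clopen_bot clopen_content_clopen nu_bot.
rewrite !big_ord_recr /=; apply: le_trans (clopen_content_setU _ _) _ => //.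
  by rewrite -bigcup_mkord; apply: bigcup_open => i _; exact: oO.
exact: leeD.
Qed.

Lemma clopen_outer_le (E O : set T) : open O -> E `<=` O -> outer E <= inner O.
Proof. by move=> oO EO; apply: ereal_inf_lbound; exists O. Qed.

Lemma clopen_outer_ge (E : set T) c :
  (forall O : set T, open O -> E `<=` O -> c <= inner O) -> c <= outer E.
Proof. by move=> h; apply: le_ereal_inf_tmp => _ [V [oV EV] <-]; exact: h. Qed.

Lemma clopen_outer_open (O : set T) : open O -> outer O = inner O.
Proof.
move=> oO; apply/eqP; rewrite eq_le clopen_outer_le//=.
by apply: clopen_outer_ge => V _; exact: clopen_content_mono.
Qed.

Lemma clopen_outer_ge0 (E : set T) : 0 <= outer E.
Proof. by apply: clopen_outer_ge => O _ _; exact: clopen_content_ge0. Qed.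

Lemma clopen_outer_fin (E : set T) : outer E \is a fin_num.
Proof.
rewrite ge0_fin_numE ?clopen_outer_ge0//.
apply: le_lt_trans (clopen_outer_le openT (@subsetT _ E)) _.
by rewrite (le_lt_trans (clopen_content_le1 _))// ltry.
Qed.

Lemma clopen_outer_mono (E F : set T) : E `<=` F -> outer E <= outer F.
Proof.
move=> EF; apply: clopen_outer_ge => O oO FO; apply: clopen_outer_le => //.
exact: subset_trans FO.
Qed.

Lemma clopen_outer0 : outer set0 = 0.
Proof.
rewrite -clopen_bot clopen_outer_open; last exact: open_clopen.
by rewrite clopen_content_clopen nu_bot.
Qed.

Lemma clopen_outer_sigma_subadditive : sigma_subadditive outer.
Proof.
move=> F; apply/lee_addgt0Pr => e e0.
have /choice[W OP] : forall n, exists O : set T, [/\ open O, F n `<=` O &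
    inner O <= outer (F n) + (e / (2 ^ n.+1)%:R)%:E].
  move=> n; have [|_ [V [oV FV] <-] /ltW h] :=
    @lb_ereal_inf_adherent R _ (e / (2 ^ n.+1)%:R) _ (clopen_outer_fin (F n)).
    by rewrite divr_gt0// ltr0n expn_gt0.
  by exists V.
apply: le_trans (epsilon_trick xpredT _ (ltW e0)); last first.
  by move=> n; exact: clopen_outer_ge0.
apply: (@le_trans _ _ (\sum_(n <oo) inner (W n))); last first.
  apply: lee_nneseries => [n _ _|n _]; first exact: clopen_content_ge0.
  by have [] := OP n.
apply: le_trans (clopen_content_bigcup _); last by move=> n; have [] := OP n.
apply: clopen_outer_le; first by apply: bigcup_open => n _; have [] := OP n.
by apply: subset_bigcup => n _; have [] := OP n.
Qed.

Let outer_measure_outer : {outer_measure set T -> \bar R} :=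
  HB.pack outer (isOuterMeasure.Build R T outer clopen_outer0 clopen_outer_ge0
    clopen_outer_mono clopen_outer_sigma_subadditive).

(** In an open [V] containing the test set, a clopen [f] fills up the part in [O]. What lies outside
    [O] is contained in the open set [V] minus [f], which a clopen [g] fills up. Then [f] and [g]
    are disjoint, and additivity of [nu] concludes. *)
Lemma caratheodory_open (O : set T) : open O -> outer.-caratheodory O.
Proof.
move=> oO; apply: (@le_caratheodory_measurable R T outer_measure_outer) => X /=.
apply: clopen_outer_ge => V oV XV.
have oVO : open (V `&` O) by exact: openI.
have h1 : outer (X `&` O) <= inner (V `&` O).
  by apply: clopen_outer_le => //; exact: setSI.
have h2 : outer (X `&` ~` O) <= outer (V `&` ~` O).
  by apply: clopen_outer_mono; exact: setSI.
apply: le_trans (leeD h1 h2) _.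
rewrite -leeBrDr ?clopen_outer_fin//.
apply: clopen_content_le => f fVO; rewrite leeBrDr ?clopen_outer_fin//.
have oVf : open (V `&` ~` clopen_of f).
  by apply: openI => //; apply: closed_openC; exact: closed_clopen.
have h3 : outer (V `&` ~` O) <= inner (V `&` ~` clopen_of f).
  by apply: clopen_outer_le => //; apply: setIS; apply: subsetC => q /fVO[].
apply: le_trans (leeD (lexx _) h3) _.
rewrite addeC -leeBrDr//; apply: clopen_content_le => g gVf.
rewrite leeBrDr// -EFinD -(fa_disj fnu).
  apply: clopen_content_sub; rewrite clopen_disj => q [/gVf[]//|/fVO[]//].
move=> b [/(holds_toU g b) hg /(holds_toU f b) hf].
by have [_] := gVf (tp A b) hg; apply.
Qed.

Let borel_caratheodory (B : set (borel_types A Y)) : measurable B ->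
  outer.-caratheodory B.
Proof.
have := @sigma_algebra_measurable _ (caratheodory_type outer_measure_outer).
move=> /smallest_sub; apply => O; exact: caratheodory_open.
Qed.

Let borel_sigma_additive :
  semi_sigma_additive (outer : set (borel_types A Y) -> \bar R).
Proof.
move=> F mF tF mUF.
apply: (@caratheodory_measure_sigma_additive R _ outer_measure_outer) => //.
  by move=> n; exact: borel_caratheodory.
exact: borel_caratheodory.
Qed.

Let borel_measure : {measure set (borel_types A Y) -> \bar R} :=
  HB.pack (outer : set (borel_types A Y) -> \bar R)
  (isMeasure.Build _ _ R (outer : set (borel_types A Y) -> \bar R)
    clopen_outer0 clopen_outer_ge0 borel_sigma_additive).

Let outerT : outer setT = 1.
Proof.
rewrite clopen_outer_open; last exact: openT.
apply/eqP; rewrite eq_le clopen_content_le1/=.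
have <- : (nu Ftop)%:E = 1 by congr EFin; apply: (fa_top fnu) => b [].
exact: clopen_content_sub.
Qed.

Lemma borel_extension_exists : exists P : probability (borel_types A Y) R,
  regular_measure P /\ forall f, P (clopen_of f) = (nu f)%:E.
Proof.
pose P : probability (borel_types A Y) R :=
  HB.pack (outer : set (borel_types A Y) -> \bar R) borel_measure
    (Measure_isProbability.Build _ _ R borel_measure outerT).
exists P; split; last first.
  move=> f; rewrite -clopen_content_clopen; apply: clopen_outer_open.
  exact: open_clopen.
apply: outer_regular_measure => B mB.
have E : [set P V | V in [set V : set T | open V /\ B `<=` V]] =
    [set inner V | V in [set V : set T | open V /\ B `<=` V]].
  by apply/seteqP; split=> x [V [oV BV] <-]; exists V => //;
    rewrite /P /= clopen_outer_open.
by rewrite E.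
Qed.

End borel_extension.

Section regular_uniqueness.
Variables (R : realType) (L : language) (U : structure L) (A : set U).
Variables (Y : Type).
Local Open Scope ereal_scope.

Let le_open (P Q : probability (borel_types A Y) R) (V : set (types A Y)) :
    regular_measure P ->
    (forall f, P (clopen_of f) = Q (clopen_of f)) -> open V -> P V <= Q V.
Proof.
move=> rP PQ oV; have mV := measurable_open_types oV.
rewrite (rP V mV).2; apply: ge_ereal_sup => _ [C [cC CV] <-].
have [f Cf fV] := compact_open_clopen cC oV CV.
have mf : measurable (clopen_of f : set (borel_types A Y)).
  by apply: measurable_open_types; exact: open_clopen.
apply: (@le_trans _ _ (P (clopen_of f))).
  by apply: le_measure => //; rewrite inE//; exact: measurable_compact_types.
by rewrite PQ; apply: le_measure; rewrite ?inE.
Qed.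

Lemma regular_measure_unique (P Q : probability (borel_types A Y) R) :
    regular_measure P -> regular_measure Q ->
    (forall f, P (clopen_of f) = Q (clopen_of f)) ->
  forall B, measurable B -> P B = Q B.
Proof.
move=> rP rQ PQ B mB; rewrite (rP B mB).1 (rQ B mB).1; congr ereal_inf.
have E V : open V -> P V = Q V.
  by move=> oV; apply/eqP; rewrite eq_le; apply/andP; split; apply: le_open.
by apply/seteqP; split=> _ [V [oV BV] <-]; exists V => //; rewrite E.
Qed.

(** [borel_ext] is chosen by [get]; existence is what makes the chosen measure meet its
    specification. *)
Lemma borel_extP (nu : formula L (Y + A) -> R) :
    fin_additive (fun b : Y -> U => sum_case b set_val) nu ->
  regular_measure (borel_ext nu) /\
    forall f, borel_ext nu (clopen_of f) = (nu f)%:E.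
Proof. by move=> fnu; have := getPex (borel_extension_exists fnu). Qed.

End regular_uniqueness.

(** * Push-forward of Borel extensions under restriction of types *)

Section type_restriction.
Variables (R : realType) (L : language) (U : structure L) (A : set U).
Variables (Y Y' : Type) (s : Y' -> Y).

Definition rename_left (f : formula L (Y' + A)) : formula L (Y + A) :=
  frename (sum_map s id) f.

Lemma holds_rename_left f (b : Y -> U) :
  holds (toU (rename_left f)) b <-> holds (toU f) (b \o s).
Proof. by rewrite !holds_toU sat_frename sum_case_comp. Qed.

Lemma complete_type_restrict (q : types A Y) :
  complete_type [set f | sval q (rename_left f)].
Proof.
split=> [F finF Fq|f].
  have [l lE] := finite_set_list finF.
  have [b bP] := type_point q (map rename_left l).
  exists (b \o s) => f Ff; apply/holds_rename_left/bP; last exact: Fq.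
  by apply: List.in_map; apply/lE.
have [|h] := pselect (sval q (rename_left f)); [by left|right].
exact/type_neg.
Qed.

(** The map dual to renaming variables: it takes the type of [b] to the type of [b \o s]. *)
Definition type_restrict (q : types A Y) : types A Y' :=
  exist _ _ (complete_type_restrict q).

Lemma continuous_type_restrict : continuous type_restrict.
Proof.
apply/continuousP => V oV.
suff : types_open (type_restrict @^-1` V) by [].
move=> q Vq; have [f qf fV] := oV _ Vq.
by exists (rename_left f) => // r rf; apply: fV.
Qed.

Lemma measurable_type_restrict :
  measurable_fun [set: borel_types A Y]
    (type_restrict : borel_types A Y -> borel_types A Y').
Proof.
apply: (@measurability _ _ (borel_types A Y) (borel_types A Y') setT
  type_restrict (@open (types A Y')) erefl).
move=> _ [V oV <-]; rewrite setTI; apply: measurable_open_types.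
by have /continuousP h := continuous_type_restrict; apply: (h V oV).
Qed.

Let tr : {mfun borel_types A Y >-> borel_types A Y'} :=
  HB.pack (type_restrict : borel_types A Y -> borel_types A Y')
    (isMeasurableFun.Build _ _ _ _ _ measurable_type_restrict).

(** By uniqueness it suffices that the push-forward is regular. For outer regularity at [B], take a
    compact [C] nearly filling the preimage of the complement of [B]. Its image is compact, and the
    complement of this image is an open set containing [B], only slightly larger in measure. *)
Lemma borel_ext_restrict (nu : formula L (Y + A) -> R)
    (nu' : formula L (Y' + A) -> R) :
    fin_additive (fun b : Y -> U => sum_case b set_val) nu ->
    fin_additive (fun b : Y' -> U => sum_case b set_val) nu' ->
    (forall f, nu (rename_left f) = nu' f) ->
  forall B, measurable B ->
    borel_ext nu' B = borel_ext nu (type_restrict @^-1` B).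
Proof.
move=> fnu fnu' nn' B mB.
have [r E] := borel_extP fnu; have [r' E'] := borel_extP fnu'.
suff : borel_ext nu' B = distribution (borel_ext nu) tr B by [].
move: B mB; apply: (regular_measure_unique r'); last first.
  by move=> f; rewrite E' -nn' -E.
apply: outer_regular_measure => {}B mB.
pose P := borel_ext nu.
rewrite -[LHS]/(P (type_restrict @^-1` B)).
have mtr (V : set (borel_types A Y')) : measurable V ->
    measurable (type_restrict @^-1` V : set (borel_types A Y)).
  by move=> mV; rewrite -[X in measurable X]setTI; exact: measurable_type_restrict.
apply/eqP; rewrite eq_le; apply/andP; split.
  apply: le_ereal_inf_tmp => _ [V [oV BV] <-].
  rewrite -[leRHS]/(P (type_restrict @^-1` V)).
  apply: le_measure; rewrite ?inE; [exact: mtr| |exact: preimage_subset].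
  by apply: mtr; exact: measurable_open_types.
apply/lee_addgt0Pr => e e0.
have mBC : measurable (type_restrict @^-1` (~` B) : set (borel_types A Y)).
  by apply: mtr; exact: measurableC.
have finBC : P (type_restrict @^-1` (~` B)) \is a fin_num by exact: fin_num_measure.
have [_ supE] := r _ mBC.
have [|_ [C [cC CB] <-] /ltW] := @ub_ereal_sup_adherent R
    [set P C | C in [set C : set (types A Y) |
      compact C /\ C `<=` type_restrict @^-1` (~` B)]] e e0.
  by rewrite -supE.
rewrite -supE => h.
have mC : measurable (C : set (borel_types A Y)) by exact: measurable_compact_types.
have finC : P C \is a fin_num by exact: fin_num_measure.
have cD : compact (type_restrict @` C).
  apply: continuous_compact cC; apply: continuous_subspaceT.
  exact: continuous_type_restrict.
have oV : open (~` (type_restrict @` C)).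
  by apply: closed_openC; exact: compact_closed (@types_hausdorff _ _ _ _) cD.
apply: (@le_trans _ _ (P (type_restrict @^-1` (~` (type_restrict @` C))))).
  apply: ereal_inf_lbound; exists (~` (type_restrict @` C)) => //; split=> //.
  by move=> q Bq [q' Cq' qq']; apply: (CB _ Cq'); rewrite qq'.
apply: (@le_trans _ _ (P (~` C))).
  apply: le_measure; rewrite ?inE.
  - by apply: mtr; exact: measurable_open_types.
  - exact: measurableC.
  - by move=> q h' Cq; apply: h'; exists q.
have -> : type_restrict @^-1` B = ~` (type_restrict @^-1` (~` B)).
  by rewrite preimage_setC setCK.
rewrite (probability_setC P mC) (probability_setC P mBC).
move: finBC finC h => /fineK <- /fineK <-.
rewrite -!EFinB -!EFinD !lee_fin; lra.
Qed.

Lemma Rintegral_type_restrict (nu : formula L (Y + A) -> R)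
    (nu' : formula L (Y' + A) -> R) (F : types A Y' -> R) :
    fin_additive (fun b : Y -> U => sum_case b set_val) nu ->
    fin_additive (fun b : Y' -> U => sum_case b set_val) nu' ->
    (forall f, nu (rename_left f) = nu' f) ->
    measurable_fun [set: borel_types A Y'] (F : borel_types A Y' -> R) ->
    (forall q, 0 <= F q) ->
  \int[borel_ext nu']_(q in [set: borel_types A Y']) F q =
  \int[borel_ext nu]_(q in [set: borel_types A Y]) F (type_restrict q).
Proof.
move=> fnu fnu' nn' mF F0; congr fine.
rewrite (eq_measure_integral (distribution (borel_ext nu) tr)); last first.
  by move=> B mB _; exact: borel_ext_restrict.
rewrite ge0_integral_distribution//.
exact/measurable_realfun.measurable_EFinP.
Qed.

End type_restriction.

(** * Morley products over a model *)

Lemma factor_right L (V W : Type) (p : formula L (V + W)) :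
  exists n (h : 'I_n -> W) (p0 : formula L (V + 'I_n)),
    p = frename (sum_map id h) p0.
Proof.
have [n [h hP]] : exists n (h : 'I_n -> W), [set w | ffree p (inr w)] `<=` range h.
  apply: finite_set_enum; apply: (@finite_preimage _ _ _ inr _ (finite_ffree p)).
  by move=> x y _ _ [].
have [|p0 ->] := @ffree_factor L _ _ (sum_map (id : V -> V) h) p.
  move=> [v|w] pw; first by exists (inl v).
  by have [i _ <-] := hP w pw; exists (inr i).
by exists n, h, p0.
Qed.

Lemma fin_additive_rename (R : realType) L (U : structure L) (V W S S' : Type)
    (e : S -> W -> U) (e' : S' -> V -> U) (t : V -> W) (nu : formula L W -> R) :
    fin_additive e nu -> (forall s, exists s', e s \o t = e' s') ->
  fin_additive e' (fun p => nu (frename t p)).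
Proof.
move=> fnu ee'; case: (fnu) => nu0 nueq nu1 nuD; split=> //.
- move=> p q pq; apply: nueq => s; rewrite !sat_frename.
  by have [s' ->] := ee' s.
- move=> p q pq; apply: nuD => s; rewrite !sat_frename.
  by have [s' ->] := ee' s.
Qed.

Lemma holds_instU L (U : structure L) (X Y : Type)
    (p : formula L ((X + Y) + U)) (b : Y -> U) (a : X -> U) :
  holds (instU p b) a <-> sat p (sum_case (sum_case a b) id).
Proof.
rewrite /holds /instU sat_frename.
suff -> : sum_case a id \o sum_case (sum_map id b) inr =
  sum_case (sum_case a b) id by [].
by apply/funext => -[[x|y]|u].
Qed.

Lemma holds_inst L (U : structure L) (X Y : Type) (p : formula L (X + Y))
    (b : Y -> U) (a : X -> U) :
  holds (inst p b) a <-> sat p (sum_case a b).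
Proof. by rewrite /holds /inst sat_frename sum_case_comp. Qed.

Lemma params_toU L (U : structure L) (A : set U) (V : Type)
    (p : formula L (V + A)) : params (toU p) `<=` A.
Proof.
move=> u; rewrite /params /= ffree_frename => -[[//|a] _ [<-]].
exact: set_valP.
Qed.

Lemma toU_factor L (U : structure L) (A : set U) (V : Type)
    (p : formula L (V + U)) : params p `<=` A ->
  exists p0 : formula L (V + A), p = toU p0.
Proof.
move=> pA; apply: ffree_factor => -[v|u] pu; first by exists (inl v).
by exists (inr (exist _ u (mem_set (pA u pu)))).
Qed.

Lemma subst_vars_toU L (U : structure L) (A : set U) (V W : Type) (s : V -> W)
    (p : formula L (V + A)) : subst_vars s (toU p) = toU (rename_left s p).
Proof.
rewrite /subst_vars /toU /rename_left !frename_comp !sum_map_comp.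
by congr frename.
Qed.

Section morley_over_model.
Variables (R : realType) (L : language) (U : structure L) (K : Type).
Variables (M : set U) (X : finType) (mu : formula L (X + U) -> R).
Hypotheses (monsterU : monster K U) (smallM : small K M).
Hypotheses (measmu : keisler_measure mu) (bdmu : borel_definable M mu).

Let fmu : fin_additive (fun a : X -> U => sum_case a id) mu.
Proof. exact: measmu. Qed.

Section fibers.
Variable Y : finType.
Implicit Types (p : formula L ((X + Y) + M)) (q : types M Y).

Let hold p (a : X -> U) (b : Y -> U) := sat p (sum_case (sum_case a b) set_val).

Lemma holds_instU_toU p b a : holds (instU (toU p) b) a <-> hold p a b.
Proof. by rewrite holds_instU /toU sat_frename sum_case_comp. Qed.

(** Invariance concerns [L]-formulas, so the finitely many parameters of [p], listed by [h], are
    appended to the tuples. The longer tuples still have the same type over [M], as [h] takes values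
    in [M]. *)
Lemma mu_instU_realizes p q b c : realizes b q -> realizes c q ->
  mu (instU (toU p) b) = mu (instU (toU p) c).
Proof.
move=> bq cq; have [n [h [p0 pE]]] := factor_right p.
pose r (z : (X + Y) + 'I_n) : X + (Y + 'I_n) :=
  match z with
  | inl (inl x) => inl x
  | inl (inr y) => inr (inl y)
  | inr i => inr (inr i)
  end.
have E d : mu (instU (toU p) d) =
    mu (inst (frename r p0) (sum_case d (set_val \o h))).
  apply: (fa_eq fmu) => a; rewrite -![sat _ _]/(holds _ _).
  rewrite holds_instU_toU holds_inst /hold pE !sat_frename.
  suff -> : sum_case (sum_case a d) set_val \o sum_map id h =
    sum_case a (sum_case d (set_val \o h)) \o r by [].
  by apply/funext => -[[x|y]|i].
rewrite !E; apply: bdmu.1 => f.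
pose t (z : (Y + 'I_n) + M) : Y + M :=
  match z with
  | inl (inl y) => inl y
  | inl (inr i) => inr (h i)
  | inr m => inr m
  end.
have H d : holds (toU f) (sum_case d (set_val \o h)) <->
    holds (toU (frename t f)) d.
  rewrite !holds_toU sat_frename.
  suff -> : sum_case (sum_case d (set_val \o h)) set_val =
    sum_case d set_val \o t by [].
  by apply/funext => -[[y|i]|m].
by rewrite !H -(realizesP bq) -(realizesP cq).
Qed.

Lemma fiberE p q b : realizes b q ->
  fiber mu (toU p) q = mu (instU (toU p) b).
Proof.
move=> bq; rewrite /fiber; set P := [set r | _].
have [c cq ->] : P (get P) by apply: getPex; exists (mu (instU (toU p) b)), b.
exact: mu_instU_realizes cq bq.
Qed.

Lemma fiber01 p q : 0 <= fiber mu (toU p) q <= 1.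
Proof.
have [b bq] := realize_type monsterU q smallM.
by rewrite (fiberE p bq) (fa_ge0 fmu) (fa_le1 fmu).
Qed.

Lemma measurable_fiber p :
  measurable_fun [set: borel_types M Y] (fiber mu (toU p) : borel_types M Y -> R).
Proof. exact: bdmu.2. Qed.

Lemma integrable_fiber (P : probability (borel_types M Y) R) p :
  P.-integrable [set: borel_types M Y]
    (EFin \o (fiber mu (toU p) : borel_types M Y -> R)).
Proof.
apply: measurable_bounded_integrable => //.
- by apply: fin_num_fun_lty; exact: fin_num_measure.
- exact: measurable_fiber.
- exists 1; split=> // r r1 q _ /=.
  have /andP[h0 h1] := fiber01 p q.
  by rewrite ger0_norm// (le_trans h1)// ltW.
Qed.

Lemma fin_additive_integral_fiber (P : probability (borel_types M Y) R) :
  fin_additive (fun s : (X -> U) * (Y -> U) =>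
      sum_case (sum_case s.1 s.2) set_val)
    (fun p => \int[P]_(q in [set: borel_types M Y])
      (fiber mu (toU p) : borel_types M Y -> R) q).
Proof.
split.
- move=> p; apply: Rintegral_ge0 => // q _.
  by have /andP[] := fiber01 p q.
- move=> p p' pp'; apply: eq_Rintegral => q _.
  have [b bq] := realize_type monsterU q smallM.
  rewrite !(fiberE _ bq); apply: (fa_eq fmu) => a.
  rewrite -![sat _ _]/(holds _ _) !holds_instU_toU.
  exact: (pp' (a, b)).
- transitivity (\int[P]_(q in [set: borel_types M Y]) (1 : R)).
    apply: eq_Rintegral => q _.
    have [b bq] := realize_type monsterU q smallM.
    by rewrite (fiberE _ bq); apply: (fa_top fmu) => a [].
  rewrite Rintegral_cst// mul1r; exact: (congr1 fine (probability_setT P)).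
- move=> p p' pp'; rewrite -RintegralD//; try exact: integrable_fiber.
  apply: eq_Rintegral => q _.
  have [b bq] := realize_type monsterU q smallM.
  rewrite !(fiberE _ bq) -(fa_disj fmu) => [|a].
    apply: (fa_eq fmu) => a; rewrite sat_disj.
    rewrite -![sat _ _]/(holds _ _) !holds_instU_toU.
    by [].
  rewrite -![sat _ _]/(holds _ _) !holds_instU_toU.
  exact: (pp' (a, b)).
Qed.

Lemma morleyE (nu : formula L (Y + U) -> R) p :
  morley M mu nu (toU p) =
  \int[borel_ext (restr M nu)]_(q in [set: borel_types M Y])
    (fiber mu (toU p) : borel_types M Y -> R) q.
Proof.
rewrite /morley.
have -> : M `|` params (toU p) = M by apply/setUidl; exact: params_toU.
by [].
Qed.

End fibers.

Definition morley_restr n : formula L ('I_n.+1 * X + M) -> R :=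
  restr M (@morley_pow R L U X M mu n).

Lemma morley_restrS n (p : formula L ('I_n.+2 * X + M)) :
  morley_restr p = \int[borel_ext (@morley_restr n)]_(q in
      [set: borel_types M ('I_n.+1 * X)%type])
    (fiber mu (toU (rename_left (@split_first X n.+1) p)) :
       borel_types M ('I_n.+1 * X)%type -> R) q.
Proof. by rewrite -morleyE /morley_restr /restr /= subst_vars_toU. Qed.

Lemma fin_additive_morley n :
  fin_additive (fun a : 'I_n.+1 * X -> U => sum_case a set_val)
    (@morley_restr n).
Proof.
case: n => [|n].
  have := @fin_additive_rename R L U ('I_1 * X + M) (X + U) _
    ('I_1 * X -> U) (fun a : X -> U => sum_case a id)
    (fun a => sum_case a set_val) (sum_map snd set_val) mu fmu.
  have -> : (fun p => mu (frename (sum_map snd set_val) p)) = @morley_restr 0.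
    apply/funext => p; rewrite /morley_restr /restr /= /subst_vars /toU.
    by rewrite frename_comp sum_map_comp.
  by apply => a; exists (a \o snd); rewrite sum_case_comp.
have := fin_additive_rename (fin_additive_integral_fiber (borel_ext (@morley_restr n))).
move=> /(_ _ _ (fun a => sum_case a set_val) (sum_map (@split_first X n.+1) id)).
have -> : @morley_restr n.+1 = (fun p => \int[borel_ext (@morley_restr n)]_(q in
      [set: borel_types M ('I_n.+1 * X)%type])
    (fiber mu (toU (rename_left (@split_first X n.+1) p)) :
       borel_types M ('I_n.+1 * X)%type -> R) q).
  by apply/funext => p; exact: morley_restrS.
by apply => s; exists (sum_case s.1 s.2 \o @split_first X n.+1); rewrite sum_case_comp.
Qed.


Lemma holds_instU_rename (Y Z : Type) (t : Z -> X + Y) (p : formula L (Z + M))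
    (a : X -> U) (b : Y -> U) :
  holds (instU (toU (rename_left t p)) b) a <->
  holds (toU p) (sum_case a b \o t).
Proof.
by rewrite holds_instU /holds /toU /rename_left !sat_frename !sum_case_comp.
Qed.

Let increasing m n (s : 'I_m -> 'I_n) := forall i j : 'I_m, (i < j)%N -> (s i < s j)%N.

Let increasing_lift m n (s : 'I_m -> 'I_n.+1) (s' : 'I_m -> 'I_n) :
  (forall i, s i = lift ord0 (s' i)) -> increasing s -> increasing s'.
Proof. by move=> ss' si i j /si; rewrite !ss' !lift0. Qed.

(** The induction follows how [s] treats the variable [x_0], which [mu] measures inside the
    integral. Variables are dropped but never permuted, as the Morley product need not commute. *)
Lemma morley_restr_increasing n m (s : 'I_m.+1 -> 'I_n.+1)
    (p : formula L ('I_m.+1 * X + M)) :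
    (forall i j : 'I_m.+1, (i < j)%N -> (s i < s j)%N) ->
  @morley_restr n (rename_left (fun z => (s z.1, z.2)) p) = @morley_restr m p.
Proof.
elim: n m s p => [|n IH] m s p si.
  case: m s p si => [|m] s p si; last first.
    by have := si ord0 (lift ord0 ord0); rewrite !ord1 lift0 => /(_ isT).
  apply: (fa_eq (fin_additive_morley 0)) => a.
  rewrite -!holds_toU holds_rename_left.
  suff -> : a \o (fun z => (s z.1, z.2)) = a by [].
  by apply/funext => -[i x] /=; rewrite ord1 (ord1 i).
have [s0|s0] := eqVneq (s ord0) ord0; last first.
  have /choice[s' s'E] : forall i, exists j : 'I_n.+1, s i = lift ord0 j.
    move=> i; case: (unliftP ord0 (s i)) => [j ->|si0]; first by exists j.
    have [i0|i0] := eqVneq i ord0; first by rewrite -i0 si0 eqxx in s0.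
    by have := si ord0 i; rewrite si0 lt0n => /(_ i0).
  rewrite -(IH m s' p (increasing_lift s'E si)) morley_restrS.
  (* Here [x_0] does not occur: the fiber is the indicator of a clopen set, and its integral is the
     measure of [p']. *)
  pose p' := rename_left (fun z : 'I_m.+1 * X => (s' z.1, z.2)) p.
  have E (q : types M ('I_n.+1 * X)%type) :
      fiber mu (toU (rename_left (@split_first X n.+1)
        (rename_left (fun z => (s z.1, z.2)) p))) q = \1_(clopen_of p') q.
    have [b bq] := realize_type monsterU q smallM.
    rewrite (fiberE _ bq) indicE.
    have H a : holds (instU (toU (rename_left (@split_first X n.+1)
        (rename_left (fun z => (s z.1, z.2)) p))) b) a <-> sval q p'.
      rewrite (realizesP bq) holds_instU_rename !holds_rename_left.
      suff -> : (sum_case a b \o @split_first X n.+1) \o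
        (fun z : 'I_m.+1 * X => (s z.1, z.2)) = b \o (fun z => (s' z.1, z.2)) by [].
      by apply/funext => -[i x]; rewrite /= /split_first /= s'E liftK.
    have [qp|nqp] := pselect (sval q p').
      rewrite mem_set//; apply: (fa_top fmu) => a.
      exact/(H a).
    rewrite memNset//; apply: (fa_bot fmu) => a ha; apply: nqp.
    exact/(H a).
  transitivity (\int[borel_ext (@morley_restr n)]_(q in
      [set: borel_types M ('I_n.+1 * X)%type])
      (\1_(clopen_of p' : set (borel_types M ('I_n.+1 * X)%type)) q : R)).
    by apply: eq_Rintegral => q _; exact: E.
  have mp' : measurable (clopen_of p' : set (borel_types M ('I_n.+1 * X)%type)).
    by apply: measurable_open_types; exact: open_clopen.
  rewrite /Rintegral integral_indic// setIT.
  by have [_ h] := borel_extP (fin_additive_morley n); exact: (congr1 fine (h p')) .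
(* When only [x_0] occurs, the fiber is constant and the integral is over a space of mass 1. *)
case: m s p si s0 => [|m] s p si s0.
  rewrite morley_restrS.
  transitivity (\int[borel_ext (@morley_restr n)]_(q in
      [set: borel_types M ('I_n.+1 * X)%type]) (@morley_restr 0 p)).
    apply: eq_Rintegral => q _.
    have [b bq] := realize_type monsterU q smallM.
    rewrite (fiberE _ bq); apply: (fa_eq fmu) => a.
    rewrite -![sat _ _]/(holds _ _) holds_instU_rename holds_rename_left.
    rewrite subst_vars_toU holds_rename_left.
    suff -> : (sum_case a b \o @split_first X n.+1) \o
      (fun z : 'I_1 * X => (s z.1, z.2)) = a \o snd by [].
    by apply/funext => -[i x]; rewrite /= /split_first /= ord1 s0 unlift_none.
  rewrite Rintegral_cst//.
  rewrite (congr1 fine (probability_setT (borel_ext (@morley_restr n)))) mulr1.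
  by [].
have /choice[s' s'E] : forall i : 'I_m.+1, exists j : 'I_n.+1,
    s (lift ord0 i) = lift ord0 j.
  move=> i; case: (unliftP ord0 (s (lift ord0 i))) => [j ->|si0].
    by exists j.
  by have := si ord0 (lift ord0 i); rewrite si0 lift0 => /(_ isT).
have s'i : increasing s'.
  move=> i j ij; have := si (lift ord0 i) (lift ord0 j).
  by rewrite !s'E !lift0; exact.
(* Both fibers measure [x_0] in the same way; the integrals over the other variables are matched by
   restricting types along [s']. *)
rewrite !morley_restrS.
rewrite (Rintegral_type_restrict (s := fun z : 'I_m.+1 * X => (s' z.1, z.2))
  (fin_additive_morley n) (fin_additive_morley m)); last 3 first.
- by move=> f; exact: IH.
- exact: measurable_fiber.
- by move=> q; have /andP[] := fiber01 (rename_left (@split_first X m.+1) p) q.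
apply: eq_Rintegral => q _.
have [b bq] := realize_type monsterU q smallM.
have bq' : realizes (b \o (fun z : 'I_m.+1 * X => (s' z.1, z.2)))
    (type_restrict (fun z : 'I_m.+1 * X => (s' z.1, z.2)) q).
  by move=> f qf; apply/holds_rename_left/bq.
rewrite (fiberE _ bq) (fiberE _ bq'); apply: (fa_eq fmu) => a.
rewrite -![sat _ _]/(holds _ _) !holds_instU_rename holds_rename_left.
suff -> : (sum_case a b \o @split_first X n.+1) \o
    (fun z : 'I_m.+2 * X => (s z.1, z.2)) =
  sum_case a (b \o (fun z => (s' z.1, z.2))) \o @split_first X m.+1 by [].
apply/funext => -[i x]; rewrite /= /split_first /=.
case: (unliftP ord0 i) => [j ->|->]; first by rewrite s'E liftK.
by rewrite s0 unlift_none.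
Qed.

End morley_over_model.

Lemma rename_left_comp L (U : structure L) (A : set U) (V W Z : Type)
    (s : V -> W) (t : W -> Z) (p : formula L (V + A)) :
  rename_left t (rename_left s p) = rename_left (t \o s) p.
Proof. by rewrite /rename_left frename_comp sum_map_comp. Qed.

Lemma omega_factor L (U : structure L) (A : set U) (X : Type)
    (p : formula L (nat * X + A)) : exists N, forall n, (N <= n)%N ->
  exists p0, p = rename_left (@to_omega X n.+1) p0.
Proof.
have [N NP] : exists N, forall z, ffree p (inl z) -> (z.1 <= N)%N.
  have fin : finite_set [set z | ffree p (inl z)].
    apply: (@finite_preimage _ _ _ inl _ (finite_ffree p)).
    by move=> x y _ _ [].
  have [l lE] := finite_set_list fin.
  suff [N NP] : exists N, forall z, List.In z l -> (z.1 <= N)%N.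
    by exists N => z /lE /NP.
  elim: l {lE} => [|z l [N NP]]; first by exists 0%N.
  exists (maxn z.1 N) => y [<-|/NP h]; first exact: leq_maxl.
  by rewrite (leq_trans h)// leq_maxr.
exists N => n Nn; apply: ffree_factor => -[[i x]|m] pz.
  have iN := leq_trans (NP _ pz) Nn.
  by exists (inl (inord i, x)) => //=; rewrite /to_omega /= inordK.
by exists (inr m).
Qed.

(** * The infinite Morley power over [M] *)

Section morley_omega_over_model.
Variables (R : realType) (L : language) (U : structure L) (K : Type).
Variables (M : set U) (X : finType) (mu : formula L (X + U) -> R).
Hypotheses (monsterU : monster K U) (smallM : small K M).
Hypotheses (measmu : keisler_measure mu) (bdmu : borel_definable M mu).

Local Notation morley_r n := (@morley_restr R L U M X mu n).
Let fmorley := fin_additive_morley monsterU smallM measmu bdmu.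
Let incr := morley_restr_increasing monsterU smallM measmu bdmu.

(** Dummy variables bring both formulas to a common length. Hence the value of [mu^(omega)] over [M]
    does not depend on the representation chosen in its definition. *)
Lemma morley_restr_equiv n n' (p : formula L ('I_n.+1 * X + M))
    (p' : formula L ('I_n'.+1 * X + M)) :
    (forall a : nat * X -> U, holds (toU p) (a \o @to_omega X n.+1) <->
      holds (toU p') (a \o @to_omega X n'.+1)) ->
  morley_r n p = morley_r n' p'.
Proof.
move=> pp'; pose N := maxn n n'.
have nN : (n.+1 <= N.+1)%N by rewrite ltnS leq_maxl.
have n'N : (n'.+1 <= N.+1)%N by rewrite ltnS leq_maxr.
rewrite -(@incr N n (widen_ord nN)) ?[RHS](esym (@incr N n' (widen_ord n'N) _ _))//.
apply: (fa_eq (fmorley N)) => a; rewrite -!holds_toU !holds_rename_left.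
pose a' (z : nat * X) := a (inord z.1, z.2).
have E k (kN : (k.+1 <= N.+1)%N) :
    a \o (fun z : 'I_k.+1 * X => (widen_ord kN z.1, z.2)) = a' \o @to_omega X k.+1.
  apply/funext => -[i x]; rewrite /a' /=; congr (a (_, _)).
  by apply: val_inj; rewrite /= inordK// (leq_trans (ltn_ord i)).
by rewrite !E.
Qed.

Definition omega_restr : formula L (nat * X + M) -> R :=
  restr M (morley_omega M mu).

Lemma omega_restrE n (p : formula L ('I_n.+1 * X + M)) :
  omega_restr (rename_left (@to_omega X n.+1) p) = morley_r n p.
Proof.
rewrite /omega_restr /restr /morley_omega; set P := [set r | _].
have [n' [p' [E ->]]] : P (get P).
  apply: getPex; exists (morley_r n p), n, (toU p); split=> //.
  by rewrite subst_vars_toU.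
(* Renaming variables keeps the parameters, so the representation returned by [get] is also over
   [M]. *)
have [p0 p'E] : exists p0 : formula L ('I_n'.+1 * X + M), p' = toU p0.
  apply: toU_factor => u p'u.
  have : params (toU (rename_left (@to_omega X n.+1) p)) u.
    by rewrite E /params /= ffree_frename; exists (inr u).
  exact: params_toU.
rewrite p'E; apply: morley_restr_equiv => a.
rewrite -(holds_rename_left (@to_omega X n.+1)).
by rewrite -(holds_rename_left (@to_omega X n'.+1)) -subst_vars_toU -p'E -E.
Qed.

Lemma omega_restr_increasing n (t : 'I_n.+1 -> nat)
    (p : formula L ('I_n.+1 * X + M)) :
    (forall i j : 'I_n.+1, (i < j)%N -> (t i < t j)%N) ->
  omega_restr (rename_left (fun z => (t z.1, z.2)) p) = morley_r n p.
Proof.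
move=> ti.
have tmax i : (t i < (t ord_max).+1)%N.
  rewrite ltnS; have [->//|im] := eqVneq i ord_max.
  apply: ltnW; apply: ti; rewrite ltn_neqAle leq_ord andbT.
  by apply: contraNneq im => E; exact/eqP/val_inj.
rewrite -(@incr (t ord_max) n (fun i => inord (t i))); last first.
  by move=> i j ij; rewrite !inordK//; exact: ti.
rewrite -omega_restrE rename_left_comp; congr (omega_restr (rename_left _ _)).
by apply/funext => -[i x]; rewrite /= /to_omega /= inordK.
Qed.

(** A shift is an increasing renaming. Thanks to this, shifting a Keisler-Morley measure gives
    another one. *)
Lemma omega_restr_shift k (p : formula L (nat * X + M)) :
  omega_restr (rename_left (fun z => ((k + z.1)%N, z.2)) p) = omega_restr p.
Proof.
have [N /(_ N (leqnn N))[p0 ->]] := omega_factor p.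
rewrite omega_restrE rename_left_comp.
rewrite -(@omega_restr_increasing N (fun i => (k + i)%N))//.
by move=> i j ij; rewrite ltn_add2l.
Qed.

Lemma fin_additive_omega :
  fin_additive (fun a : nat * X -> U => sum_case a set_val) omega_restr.
Proof.
have two p q : exists n (p0 q0 : formula L ('I_n.+1 * X + M)),
    p = rename_left (@to_omega X n.+1) p0 /\
    q = rename_left (@to_omega X n.+1) q0.
  have [N NP] := omega_factor p; have [N' NP'] := omega_factor q.
  exists (maxn N N').
  have [p0 ->] := NP _ (leq_maxl N N'); have [q0 ->] := NP' _ (leq_maxr N N').
  by exists p0, q0.
have ext n (a : 'I_n.+1 * X -> U) : exists a', a = a' \o @to_omega X n.+1.
  exists (fun z => a (inord z.1, z.2)); apply/funext => -[i x] /=.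
  by rewrite inord_val.
split.
- move=> p; have [n [p0 [_ [-> _]]]] := two p p.
  by rewrite omega_restrE; exact: fa_ge0 (fmorley n) _.
- move=> p q; have [n [p0 [q0 [-> ->]]]] := two p q => pq.
  rewrite !omega_restrE; apply: (fa_eq (fmorley n)) => a.
  have [a' ->] := ext n a.
  by rewrite -!holds_toU -!(holds_rename_left (@to_omega X n.+1)) !holds_toU.
- rewrite -[Ftop]/(rename_left (@to_omega X 1) Ftop) omega_restrE.
  by apply: (fa_top (fmorley 0)) => a [].
- move=> p q; have [n [p0 [q0 [-> ->]]]] := two p q => pq.
  rewrite -[Fdisj _ _]/(rename_left (@to_omega X n.+1) (Fdisj p0 q0)).
  rewrite !omega_restrE; apply: (fa_disj (fmorley n)) => a.
  have [a' ->] := ext n a.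
  by rewrite -!holds_toU -!(holds_rename_left (@to_omega X n.+1)) !holds_toU.
Qed.

End morley_omega_over_model.

(** * Self-averaging measures *)

Lemma increasing_step (t : nat -> nat) : (forall n, (t n < t n.+1)%N) ->
  forall i j, (i < j)%N -> (t i < t j)%N.
Proof.
move=> tS i; elim=> // j IH; rewrite ltnS leq_eqVlt => /predU1P[->|/IH h] //.
exact: ltn_trans (tS j).
Qed.

Lemma frequently_increasing (P : nat -> Prop) :
    (forall N, exists i, (N <= i)%N /\ P i) ->
  exists t : nat -> nat, (forall i j, (i < j)%N -> (t i < t j)%N) /\
    forall n, P (t n).
Proof.
move=> /choice[g gP].
pose t := fix t n := if n is n'.+1 then g (t n').+1 else g 0%N.
exists t; split; last by case=> [|n]; exact: (gP _).2.
by apply: increasing_step => n; exact: (gP _).1.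
Qed.

Lemma keisler_morleyE (R : realType) L (U : structure L) (M : set U)
    (X : finType) (mu : formula L (X + U) -> R) lambda :
  keisler_morley M mu lambda ->
  forall p : formula L (nat * X + M), lambda (toU p) = omega_restr mu p.
Proof. by move=> [_ E] p; exact: (congr1 (fun f => f p) E). Qed.

(** * Part (a): from fim to self-averaging *)

Section fim_implies_self_averaging.
Variables (R : realType) (L : language) (U : structure L) (K : Type).
Variables (M : set U) (X : finType) (mu : formula L (X + U) -> R).
Hypotheses (monsterU : monster K U) (smallM : small K M).
Hypotheses (measmu : keisler_measure mu) (bdmu : borel_definable M mu).

Let fmu : fin_additive (fun a : X -> U => sum_case a id) mu.
Proof. exact: measmu. Qed.

(** [lambda] is replaced by weighted sample sequences [s] with the same values at the formulas
    involved. Where [theta] holds along [t], the average at [s] is within [e] of [mu p]; elsewhere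
    the error is at most 1, on a set of mass less than [e]. Hence [e + e]. *)
Lemma fim_average (p : formula L (X + U)) (n : nat)
    (theta : formula L ('I_n.+1 * X + M)) (e : R) lambda (t : 'I_n.+1 -> nat) :
    (forall a : 'I_n.+1 -> X -> U,
       holds (toU theta) (fun z => a z.1 z.2) -> `|mu p - Av R a p| < e) ->
    1 - e < morley_pow M mu (toU theta) ->
    keisler_morley M mu lambda ->
    (forall i j : 'I_n.+1, (i < j)%N -> (t i < t j)%N) ->
  `|n.+1%:R^-1 * \sum_(i < n.+1) lambda (subst_vars (fun x => (t i, x)) p)
    - mu p| < e + e.
Proof.
move=> thetaP theta1 KMl ti.
pose th := rename_left (fun z : 'I_n.+1 * X => (t z.1, z.2)) theta.
have lth : 1 - e < lambda (toU th).
  by rewrite (keisler_morleyE KMl)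
    (omega_restr_increasing monsterU smallM measmu bdmu _ ti).
pose q i := subst_vars (fun x : X => (t i, x)) p.
have [w w1 wF] := fa_points (KMl.1 : fin_additive _ lambda)
  (toU th :: [seq q i | i : 'I_n.+1]).
have avE : n.+1%:R^-1 * \sum_(i < n.+1) lambda (q i) =
    wE w (fun s => n.+1%:R^-1 * \sum_(i < n.+1) ind R (holds (q i) s)).
  rewrite wEZ wE_sum; congr (_ * _); apply: eq_bigr => i _.
  rewrite -wF//; right; apply/List.in_map_iff; exists i; split=> //.
  have := mem_enum 'I_n.+1 i; rewrite inE.
  elim: (enum _) => // j s IH; rewrite inE => /predU1P[->|/IH]; first by left.
  by right.
rewrite avE -[X in _ - X](wE_const (mu p) w1) -wEB.
apply: (@le_lt_trans _ _ (wE w (fun s => e + (1 - ind R (holds (toU th) s)))));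
    last first.
  rewrite wED wE_const// wEB wE_const// ltrD2l ltrBlDl -ltrBlDr.
  by apply: (lt_le_trans lth); rewrite -(wF (toU th))//; left.
apply: ler_norm_wE => // s.
have avAv : n.+1%:R^-1 * \sum_(i < n.+1) ind R (holds (q i) s) =
    Av R (fun i x => s (t i, x)) p.
  rewrite /Av; congr (_ * _); apply: eq_bigr => i _.
  apply: eq_ind; rewrite /q /holds /subst_vars sat_frename sum_case_comp.
  by [].
rewrite avAv distrC.
have [hs|nhs] := pselect (holds (toU th) s).
  rewrite indT// subrr addr0; apply/ltW/thetaP.
  by move: hs; rewrite holds_rename_left.
rewrite indF// subr0.
have Av0 : 0 <= Av R (fun i x => s (t i, x)) p.
  by rewrite mulr_ge0// sumr_ge0// => i _; exact: ind_ge0.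
have Av1 : Av R (fun i x => s (t i, x)) p <= 1.
  rewrite ler_pdivrMl// mulr1 (@le_trans _ _ (\sum_(i < n.+1) (1 : R)))//.
    by apply: ler_sum => i _; exact: ind_le1.
  by rewrite sumr_const card_ord.
have := fa_ge0 fmu p; have := fa_le1 fmu p.
(* Positivity of [e] comes from the lower bound [1 - e] on a measure that is at most 1. *)
have e0 : 0 < e.
  have := fa_le1 (fin_additive_morley monsterU smallM measmu bdmu n) theta.
  by move=> /(lt_le_trans theta1); rewrite ltrBlDr ltrDl.
by move=> m1 m0; rewrite ler_norml; lra.
Qed.

Lemma fim_self_averaging : fim M mu -> self_averaging M mu.
Proof.
move=> fimmu; split=> // p lambda KMl.
(* The parameters of [p] become a tuple [h] substituted in an [L]-formula, to which fim applies. *)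
have [m [h [p0 pE]]] := factor_right p.
have {}pE : p = inst p0 h by [].
have [theta [_ theta1 theta2]] := fimmu 'I_m p0.
suff H (e : R) : 0 < e -> \forall i \near \oo,
    `|mu p - lambda (subst_vars (fun x => (i, x)) p)| < e.
  by apply/cvgrPdist_lt => e; exact: H.
(* [fim_average] doubles its error, so [e / 4] keeps all averages within [e / 2]. *)
move=> e0; pose e4 : R := e / 4.
have e40 : 0 < e4 by rewrite divr_gt0.
have [k kP] := theta1 _ e40.
have [N _ NP] := (cvgrPdist_lt _ _).1 theta2 _ e40.
pose n := maxn k N.
pose l i := lambda (subst_vars (fun x => (i, x)) p).
pose avl (t : nat -> nat) : R := n.+1%:R^-1 * \sum_(i < n.+1) l (t i).
have av (t : nat -> nat) : (forall i j, (i < j)%N -> (t i < t j)%N) ->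
  `|avl t - mu p| < e4 + e4.
  move=> ti; apply: (@fim_average _ n (theta n)) => //.
  - rewrite pE => a ha; apply: (kP n) => //.
    by rewrite (leq_trans (leq_maxl k N)).
  - have := NP n (leq_maxr k N); rewrite /= distrC ltr_norml => /andP[+ _].
    by rewrite ltrBrDl addrC.
  - by move=> i j; exact: ti.
have av_ge (t : nat -> nat) (c : R) : (forall i, c <= l (t i)) ->
    c <= avl t.
  move=> cl; rewrite /avl ler_pdivlMl// mulr_natl -[X in c *+ X]card_ord -sumr_const.
  exact: ler_sum.
have av_le (t : nat -> nat) (c : R) : (forall i, l (t i) <= c) ->
    avl t <= c.
  move=> cl; rewrite /avl ler_pdivrMl// mulr_natl -[X in c *+ X]card_ord -sumr_const.
  exact: ler_sum.
have [N1 N1P] : exists N, forall i, (N <= i)%N -> l i < mu p + e.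
  apply: contrapT => no.
  have [|t [ti tP]] := @frequently_increasing (fun i => mu p + e <= l i).
    move=> N'; apply: contrapT => no'; apply: no; exists N' => i N'i.
    by rewrite ltNge; apply/negP => h'; apply: no'; exists i.
  have := av_ge t _ tP; have := av t ti; rewrite ltr_norml /e4.
  clear pE; move: (avl t) => S.
  by move=> /andP[_ h1] h2; lra.
have [N2 N2P] : exists N, forall i, (N <= i)%N -> mu p - e < l i.
  apply: contrapT => no.
  have [|t [ti tP]] := @frequently_increasing (fun i => l i <= mu p - e).
    move=> N'; apply: contrapT => no'; apply: no; exists N' => i N'i.
    by rewrite ltNge; apply/negP => h'; apply: no'; exists i.
  have := av_le t _ tP; have := av t ti; rewrite ltr_norml /e4.
  clear pE; move: (avl t) => S.
  by move=> /andP[h1 _] h2; lra.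
exists (maxn N1 N2) => // i /=; rewrite geq_max => /andP[/N1P h1 /N2P h2].
by rewrite -/(l i) ltr_norml; clear pE; lra.
Qed.

End fim_implies_self_averaging.

(** Elementarity first passes from finite to arbitrary variable sets, because a formula has finitely
    many free variables; then it is applied to the existential closure. *)
Lemma elementary_solution L (U : structure L) (M : set U) (Z : Type)
    (p : formula L (Z + M)) : elementary_substructure M ->
  (exists a : Z -> U, sat p (sum_case a set_val)) ->
  exists a : Z -> M, sat p (sum_case (set_val \o a) set_val).
Proof.
move=> [ne [cl elem]].
have elemT (V : Type) (q : formula L V) (v : V -> M) :
    @sat L (substructure ne cl) V q v <-> @sat L U V q (set_val \o v).
  have [n [h hP]] := finite_set_enum (finite_ffree q).
  have [q0 ->] := ffree_factor hP.
  by rewrite !sat_frename; exact: elem.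
have [p' p'E] := ex_close p.
move=> /(p'E U); rewrite -[set_val]/(set_val \o id) -elemT => /p'E[a].
rewrite elemT => pa; exists a; congr (sat p _): pa.
by apply/funext => -[].
Qed.

(** If each colour were avoided by all lists above some [G x], the concatenation of the [G x] would
    have no possible colour. *)
Lemma pigeonhole_cofinal T (C : finType) (c : seq T -> C) :
  exists x, forall G, exists F, List.incl G F /\ c F = x.
Proof.
apply: contrapT => no.
have /choice[G GP] : forall x, exists G, forall F, List.incl G F -> c F <> x.
  move=> x; apply: contrapT => nx; apply: no; exists x => G.
  apply: contrapT => nG; apply: nx; exists G => F GF cF.
  by apply: nG; exists F.
pose F := flatten [seq G x | x <- enum C].
apply: (GP (c F) F) => // y yG; rewrite /F.
have := mem_enum C (c F); rewrite inE.
elim: (enum C) => // x s IH; rewrite inE => /predU1P[E|/IH h] /=.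
  by apply/List.in_app_iff; left; rewrite -E.
by apply/List.in_app_iff; right.
Qed.

(** * Construction of Keisler-Morley measures by limits *)

Section keisler_morley_measures.
Variables (R : realType) (L : language) (U : structure L) (K : Type).
Variables (M : set U) (X : finType) (mu : formula L (X + U) -> R).
Hypotheses (monsterU : monster K U) (smallM : small K M).
Hypotheses (measmu : keisler_measure mu) (bdmu : borel_definable M mu).

Let fmu : fin_additive (fun a : X -> U => sum_case a id) mu.
Proof. exact: measmu. Qed.

Let fomega : fin_additive (fun a : nat * X -> U => sum_case a set_val)
  (omega_restr mu : formula L (nat * X + M) -> R).
Proof. exact: (fin_additive_omega monsterU smallM measmu bdmu). Qed.

Section transfer.
Variables (I : Type) (V : set_system I) (VU : UltraFilter V) (Y : finType).
Variables (b : I -> Y -> U) (b' : Y -> U).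
Hypothesis b'P : forall f : formula L (Y + M),
  (\forall i \near V, holds (toU f) (b i)) -> holds (toU f) b'.

(** The existence of a counterexample to [p] is a formula over [M] in the variables [Y]. Were it
    true along [V] at the [b i], it would be true at [b']; the ultrafilter therefore contains its
    negation. *)
Let near_sat (p : formula L ((nat * X + Y) + M)) :
    (forall a, sat p (sum_case (sum_case a b') set_val)) ->
  \forall i \near V, forall a, sat p (sum_case (sum_case a (b i)) set_val).
Proof.
have [PV _] := VU => pb'.
pose r (z : (nat * X + Y) + M) : nat * X + (Y + M) :=
  match z with
  | inl (inl x) => inl x
  | inl (inr y) => inr (inl y)
  | inr m => inr (inr m)
  end.
have [g gE] := ex_close (frename r (Fneg p)).
have gP c : holds (toU g) c <-> exists a, ~ sat p (sum_case (sum_case a c) set_val).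
  rewrite holds_toU gE; split=> -[a pa]; exists a; move: pa;
    rewrite sat_frename sat_neg.
    suff -> : sum_case a (sum_case c set_val) \o r =
      sum_case (sum_case a c) set_val by [].
    by apply/funext => -[[x|y]|m].
  suff -> : sum_case a (sum_case c set_val) \o r =
    sum_case (sum_case a c) set_val by [].
  by apply/funext => -[[x|y]|m].
have [Vg|Vng] := in_ultra_setVsetC [set i | holds (toU g) (b i)] VU.
  by have /gP[a /(_ (pb' a))] := b'P Vg.
apply: filterS Vng => i /= ng a; apply: contrapT => na; apply: ng.
by apply/gP; exists a.
Qed.

(** The limit of the measures [lam i], read along the tuples [b i], is a measure
  over [M b'] which extends to the whole of [U]. *)
Lemma keisler_morley_transfer (lam : I -> formula L (nat * X + U) -> R) :
    (forall i, keisler_measure (lam i)) ->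
    (forall p : formula L (nat * X + M),
      \forall i \near V, lam i (toU p) = omega_restr mu p) ->
  exists lam', keisler_morley M mu lam' /\
    forall p : formula L ((nat * X + Y) + M),
      lam' (instU (toU p) b') = ulim V (fun i => lam i (instU (toU p) (b i))).
Proof.
move=> klam lamM; have [PV _] := VU.
have flam i : fin_additive (fun a : nat * X -> U => sum_case a id) (lam i).
  exact: klam.
have satE (p : formula L ((nat * X + Y) + M)) c (a : nat * X -> U) :
    sat (instU (toU p) c) (sum_case a id) <->
    sat p (sum_case (sum_case a c) set_val).
  by rewrite -[sat _ _]/(holds _ _) holds_instU /toU sat_frename sum_case_comp.
pose nu i (p : formula L ((nat * X + Y) + M)) := lam i (instU (toU p) (b i)).
have fnu : fin_additive
    (fun a : nat * X -> U => sum_case (sum_case a b') set_val)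
    (fun p => ulim V (nu^~ p)).
  apply: (fin_additive_ulim VU).
  - by move=> i p; rewrite (fa_ge0 (flam i)) (fa_le1 (flam i)).
  - by move=> i; apply: (fa_top (flam i)) => a; apply/satE => -[].
  - move=> p q pq.
    have pq' a : sat (Fconj (Fimp p q) (Fimp q p))
        (sum_case (sum_case a b') set_val).
      by apply/sat_conj; split=> /= /pq.
    apply: filterS (near_sat pq') => i h; apply: (fa_eq (flam i)) => a.
    by rewrite !satE; have /sat_conj[] := h a.
  - move=> p q pq.
    have pq' a : sat (Fneg (Fconj p q)) (sum_case (sum_case a b') set_val).
      by rewrite sat_neg sat_conj; exact: pq.
    apply: filterS (near_sat pq') => i h; rewrite /nu -(fa_disj (flam i)) => [|a].
      by apply: (fa_eq (flam i)) => a; rewrite sat_disj.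
    by rewrite !satE => pqa; have := h a; rewrite sat_neg sat_conj.
have [lam' [flam' lam'E]] := @fin_additive_extension R L U _ (nat * X + U) _ _
  (fun a => sum_case a id) (fun p => instU (toU p) b') _
  (fun p a => satE p b' a) fnu.
exists lam'; split=> //; split=> //; apply/funext => p.
have E (c : Y -> U) : forall a : nat * X -> U,
    sat (toU p) (sum_case a id) <->
    sat (instU (toU (frename (sum_map inl id) p)) c) (sum_case a id).
  by move=> a; rewrite satE sat_frename sum_case_comp -holds_toU.
rewrite /restr (fa_eq flam' (E b')) lam'E; apply: ulim_near_eq => //.
apply: filterS (lamM p) => i h; apply: etrans h; apply/esym.
exact: fa_eq (flam i) _ _ (E (b i)).
Qed.

End transfer.

Lemma keisler_morley_exists : exists lam, keisler_morley M mu lam.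
Proof.
have [lam [flam lamE]] := @fin_additive_extension R L U _ (nat * X + U) _ _
  (fun a => sum_case a id) (@toU L U M (nat * X)%type) _
  (fun p a => holds_toU p a) fomega.
by exists lam; split=> //; apply/funext => p; exact: lamE.
Qed.

(** A limit of shifts of a Keisler-Morley measure. *)
Lemma keisler_morley_constant : self_averaging M mu ->
  exists2 lam, keisler_morley M mu lam &
    forall p i, lam (subst_vars (fun x => (i, x)) p) = mu p.
Proof.
move=> [_ sa]; have [lam KMl] := keisler_morley_exists.
have flam : fin_additive (fun a : nat * X -> U => sum_case a id) lam.
  exact: KMl.1.
have [V [VU ooV]] := ultraFilterLemma (@eventually_filter : ProperFilter \oo).
have [PV _] := VU.
pose sh k := subst_vars (U := U) (L := L) (fun z : nat * X => ((k + z.1)%N, z.2)).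
have fsh k : fin_additive (fun a : nat * X -> U => sum_case a id) (lam \o sh k).
  apply: (fin_additive_rename flam) => a.
  by exists (a \o (fun z => ((k + z.1)%N, z.2))); rewrite sum_case_comp.
exists (fun p => ulim V (fun k => lam (sh k p))).
  split.
    apply: (fin_additive_ulim VU (nu := fun k => lam \o sh k)).
    - by move=> k p; rewrite (fa_ge0 (fsh k)) (fa_le1 (fsh k)).
    - by move=> k; apply: (fa_top (fsh k)) => a [].
    - by move=> p q pq; apply: nearW => k; exact: fa_eq (fsh k) _ _ pq.
    - by move=> p q pq; apply: nearW => k; exact: fa_disj (fsh k) _ _ pq.
  apply/funext => p; apply: ulim_near_eq => //; apply: nearW => k.
  rewrite /sh subst_vars_toU (keisler_morleyE KMl).
  exact: (omega_restr_shift monsterU smallM measmu bdmu).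
(* The shifts evaluate [p] at [x_(k+i)]: a tail of a sequence which self-averaging makes converge to
   [mu p], and [V] refines the filter at infinity. *)
move=> p i; apply: ulim_cvg => //.
have h := sa p lam KMl.
have {}h : lam (subst_vars (fun x => ((k + i)%N, x)) p) @[k --> \oo] --> mu p.
  by move: h; rewrite -(cvg_shiftn i).
apply: cvg_trans h.
have -> : (fun k => lam (sh k (subst_vars (fun x => (i, x)) p))) =
    (fun k => lam (subst_vars (fun x => ((k + i)%N, x)) p)).
  apply/funext => k; rewrite /sh /subst_vars frename_comp sum_map_comp.
  by congr lam.
by move=> A; exact: ooV.
Qed.

End keisler_morley_measures.

(** Ptak's lemma is applied to the sets of indices that are bad together at some [b] for cofinally
    many [F]. A weight [v] sees finitely many indices, so the bad sets take finitely many values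
    there, and one of these recurs cofinally. *)
Lemma ptak_cofinal (R : realType) T B (d : R) (E : seq T -> nat -> B -> Prop) :
    0 < d ->
    (forall v : seq (R * nat), wprob v -> forall F, exists b : B,
      d <= wE v (fun i => ind R (E F i b))) ->
  exists2 i : nat -> nat, (forall n, (i n < i n.+1)%N) &
    forall n G, exists F b, List.incl G F /\ forall l, (l < n)%N -> E F (i l) b.
Proof.
move=> d0 dE.
have [v v1|i ii iP] := @ptak_lemma R [set S : set nat | forall G,
    exists F b, List.incl G F /\ forall k, S k -> E F k b] d d0.
  have /choice[b bP] := dE v v1.
  have [N NP] := wE_bounded_support v.
  have [C CP] := pigeonhole_cofinal
    (fun F => [set k : 'I_N | `[< E F k (b F) >]]%SET).
  pose S := [set k : nat | exists2 j : 'I_N, j \in C & k = j :> nat].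
  exists S => [G|].
    have [F [GF FC]] := CP G; exists F, (b F); split=> // k [j jC ->].
    by move: jC; rewrite -FC inE => /asboolP.
  have [F [_ FC]] := CP [::].
  apply: le_trans (bP F) _.
  (* [S] only records indices below [N]; the added term covers the other indices, which have no
     [v]-mass. *)
  rewrite -[leRHS]addr0 -NP -wED; apply: ler_wE => // k.
  have [kN|Nk] := ltnP k N; last by rewrite [X in _ + X]indT// ler_wpDl ?ind_ge0 ?ind_le1.
  rewrite [X in _ + X]indF//.
  rewrite addr0; have [Ek|nEk] := pselect (E F k (b F)).
    rewrite [leRHS]indT ?ind_le1//; exists (Ordinal kN) => //.
    by rewrite -FC inE; exact/asboolP.
  by rewrite indF ?ind_ge0.
exists i => // n G; have [S SP Si] := iP n; have [F [b [GF EF]]] := SP G.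
by exists F, b; split=> // l /Si; exact: EF.
Qed.

(** * Part (b): from self-averaging to fam *)

Section self_averaging_implies_fam.
Variables (R : realType) (L : language) (U : structure L) (K : Type).
Variables (M : set U) (X : finType) (mu : formula L (X + U) -> R).
Hypotheses (monsterU : monster K U) (smallM : small K M).
Hypothesis (elemM : elementary_substructure M).
Hypotheses (measmu : keisler_measure mu) (bdmu : borel_definable M mu).

Let fmu : fin_additive (fun a : X -> U => sum_case a id) mu.
Proof. exact: measmu. Qed.

(** Elementarity allows sample points with coordinates in [M], as fam requires of its tuple. *)
Let fomegaM : fin_additive (fun s : nat * X -> M => sum_case (set_val \o s) set_val)
  (omega_restr mu : formula L (nat * X + M) -> R).
Proof.
apply: (fa_restrict (fin_additive_omega monsterU smallM measmu bdmu)) => p.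
exact: elementary_solution.
Qed.

(** A weighted family of points of [M] uniformly within [e / 2] would be rounded, at a further cost
    of [e / 2], to a tuple contradicting the failure of fam. *)
Lemma not_fam_convex (Y : finType) (p : formula L (X + Y)) (e : R) : 0 < e ->
    ~ (exists n (a : 'I_n.+1 -> X -> U), (forall i x, M (a i x)) /\
      forall b : Y -> U, `|mu (inst p b) - Av R a (inst p b)| < e) ->
  forall w : seq (R * (X -> M)), wprob w -> exists b : Y -> U,
    e / 2 <= `|mu (inst p b) -
               wE w (fun a => ind R (holds (inst p b) (set_val \o a)))|.
Proof.
move=> e0 nfam w w1; have e20 : 0 < e / 2 by rewrite divr_gt0.
have [n [a aP]] := wE_rounding w1 e20.
apply: contrapT => no; apply: nfam; exists n, (fun i => set_val \o a i).
split=> [i x|b]; first exact: set_valP.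
have h1 : `|mu (inst p b) -
    wE w (fun a => ind R (holds (inst p b) (set_val \o a)))| < e / 2.
  by rewrite ltNge; apply/negP => h; apply: no; exists b.
have h2 := aP (fun a => ind R (holds (inst p b) (set_val \o a))) _.
rewrite (splitr e) (le_lt_trans _ (ltrD h1 (h2 _)))// => [|s]; last first.
  by rewrite ind_ge0 ind_le1.
by rewrite (le_trans _ (ler_normD _ _))// addrA subrK.
Qed.

Lemma self_averaging_fam : self_averaging M mu -> fam M mu.
Proof.
move=> samu Y p e e0; apply: contrapT => /(not_fam_convex e0) convexP.
(* A discrepancy never exceeds 1. If its [v]-mean has absolute value at least [e / 2], the indices
   where it is at least [d] have [v]-mass at least [e / 2 - d = d]. *)
pose d : R := e / 2 / 2.
have d0 : 0 < d by rewrite !divr_gt0.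
pose f (b : Y -> U) := mu (inst p b).
have /choice[w wP] : forall F : seq (formula L (nat * X + M)),
    exists w : seq (R * (nat * X -> M)), wprob w /\ forall g, List.In g F ->
      wE w (fun s => ind R (sat g (sum_case (set_val \o s) set_val))) =
      omega_restr mu g.
  by move=> F; have [w w1 wF] := fa_points fomegaM F; exists w.
pose lamF F (q : formula L (nat * X + U)) :=
  wE (w F) (fun s => ind R (holds q (set_val \o s))).
pose px (i : nat) (b : Y -> U) := subst_vars (fun x : X => (i, x)) (inst p b).
have px_holds i b (s : nat * X -> U) :
    holds (px i b) s <-> holds (inst p b) (fun x => s (i, x)).
  by rewrite /px /holds /subst_vars sat_frename sum_case_comp.
pose E F i (b : Y -> U) := d <= `|f b - lamF F (px i b)|.
have [v v1 F|i ii iP] := @ptak_cofinal R _ _ d E d0.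
  pose ev i (s : nat * X -> M) x := s (i, x).
  (* Drawing [i] by [v] and then [x_i] by [w F] is again a discrete measure on points of [M], to
     which the failure of fam applies. *)
  have [|b bP] := convexP (wbind v (fun i => wmap (ev i) (w F))).
    by apply: wprob_bind => // i; apply: wprob_map; exact: (wP F).1.
  exists b; rewrite wE_bind in bP.
  have lamE i : wE (wmap (ev i) (w F))
      (fun a => ind R (holds (inst p b) (set_val \o a))) = lamF F (px i b).
    rewrite wE_map; apply: eq_wE => s; apply: eq_ind.
    by rewrite px_holds.
  rewrite (eq_wE _ lamE) -(wE_const (mu (inst p b)) v1) -wEB in bP.
  have : `|wE v (fun i => f b - lamF F (px i b))| <=
      wE v (fun i => d + ind R (E F i b)).
    apply: ler_norm_wE => // i.
    have [Ei|nEi] := pselect (E F i b); last first.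
      rewrite indF// addr0 ltW// ltNge; apply/negP => h; exact: nEi.
    rewrite indT// (@le_trans _ _ 1)//; last by rewrite lerDr ltW.
    have m0 := fa_ge0 fmu (inst p b); have m1 := fa_le1 fmu (inst p b).
    have l0 : 0 <= lamF F (px i b).
      by apply: wE_ge0 => [|s]; [exact: (wP F).1.1|exact: ind_ge0].
    have l1 : lamF F (px i b) <= 1.
      rewrite -[leRHS](wE_const 1 (wP F).1); apply: ler_wE => [|s].
        exact: (wP F).1.
      exact: ind_le1.
    by rewrite /f ler_norml; lra.
  rewrite [leRHS]wED wE_const// => h; have := le_trans bP h.
  by rewrite (splitr (e / 2)) lerD2l.
pose T := (seq (formula L (nat * X + M)) * (Y -> U))%type.
(* Along these sets [F] grows while more and more of the indices [i l] are bad at the same tuple. *)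
pose B (ng : nat * seq (formula L (nat * X + M))) : set T :=
  [set Fb | List.incl ng.2 Fb.1 /\
            forall l, (l < ng.1)%N -> E Fb.1 (i l) Fb.2].
have [||V [VU BV]] := @ultrafilter_base _ T B (0%N, [::]).
- move=> [n G] [n' G']; exists (maxn n n', G ++ G') => -[F b] /= [GF Fb].
  split; split=> /=.
  + by move=> g gG; apply: GF; apply/List.in_app_iff; left.
  + by move=> l ln; apply: Fb; rewrite (leq_trans ln)// leq_maxl.
  + by move=> g gG; apply: GF; apply/List.in_app_iff; right.
  + by move=> l ln; apply: Fb; rewrite (leq_trans ln)// leq_maxr.
- by move=> [n G]; have [F [b Fb]] := iP n G; exists (F, b).
have [PV _] := VU.
(* [b'] realizes the limit along [V] of the types over [M] of the tuples. *)
have [|b' b'P] := @realize_finitely_satisfiable L U K monsterU Y M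
  [set g | V [set Fb : T | holds (toU g) Fb.2]] smallM.
  move=> G finG GV; have [s sE] := finite_set_list finG.
  have : V [set Fb : T | forall g, List.In g s -> holds (toU g) Fb.2].
    have : forall g, List.In g s -> V [set Fb : T | holds (toU g) Fb.2].
      by move=> g /sE; exact: GV.
    elim: s {sE} => [|g s IH] sV.
      by apply: filterS (@filterT _ V _) => Fb _ g [].
    have Vg : V [set Fb : T | holds (toU g) Fb.2] by apply: sV; left.
    have Vs : V [set Fb : T | forall g, List.In g s -> holds (toU g) Fb.2].
      by apply: IH => h hs; apply: sV; right.
    by apply: filterS (filterI Vg Vs) => Fb [h1 h2] h [<-//|]; exact: h2.
  by move=> /filter_ex[Fb FbP]; exists Fb.2 => g /sE; exact: FbP.
pose psi k : formula L ((nat * X + Y) + M) :=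
  frename (fun z => inl (sum_map (fun x : X => (k, x)) id z)) p.
have psiE k b : instU (toU (psi k)) b = px k b.
  rewrite /psi /px /instU /toU /subst_vars /inst !frename_comp.
  by congr frename; apply/funext => -[].
have [lam1 KM1 lam1E] := keisler_morley_constant monsterU smallM measmu bdmu samu.
have V1 (q : formula L (nat * X + M)) :
    \forall Fb \near V, (fun _ : T => lam1) Fb (toU q) = omega_restr mu q.
  by apply: nearW => _; exact: keisler_morleyE KM1 q.
have [lam1' [KM1' lam1'E]] := @keisler_morley_transfer R L U M X mu T V VU Y
  snd b' b'P (fun=> lam1) (fun=> KM1.1)
  V1.
have lim_f : ulim V (fun Fb : T => f Fb.2) = f b'.
  have h := samu.2 (inst p b') lam1' KM1'.
  have {}h : cst (ulim V (fun Fb : T => f Fb.2)) k @[k --> \oo] --> f b'.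
    have <- : (fun k => lam1' (px k b')) = cst (ulim V (fun Fb : T => f Fb.2)).
      apply/funext => k; rewrite -psiE lam1'E /=; congr ulim; apply/funext => Fb.
      by rewrite psiE; exact: lam1E.
    exact: h.
  exact: (cvg_unique _ (cvg_cst _) h).
have KF (Fb : T) : keisler_measure (lamF Fb.1).
  have := fin_additive_wE (fun s : nat * X -> U => sum_case s id)
    (wprob_map (fun s => set_val \o s) (wP Fb.1).1).
  suff -> : (fun q => wE (wmap (fun s => set_val \o s) (w Fb.1))
    (fun s => ind R (sat q (sum_case s id)))) = lamF Fb.1 by [].
  by apply/funext => q; rewrite wE_map.
have VF (q : formula L (nat * X + M)) :
    V [set Fb : T | lamF Fb.1 (toU q) = omega_restr mu q].
  apply: filterS (BV (0%N, [:: q])) => Fb [qF _].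
  rewrite -((wP Fb.1).2 q); last by apply: qF; left.
  by apply: eq_wE => s; apply: eq_ind; exact: holds_toU.
have [lam2 [KM2 lam2E]] := @keisler_morley_transfer R L U M X mu T V VU Y
  snd b' b'P (fun Fb => lamF Fb.1) KF VF.
have far l : d <= `|f b' - lam2 (px (i l) b')|.
  have cf : f Fb.2 @[Fb --> V] --> f b'.
    rewrite -lim_f; apply: cvg_ulim => // Fb.
    by rewrite (fa_ge0 fmu) (fa_le1 fmu).
  have cl : lamF Fb.1 (px (i l) Fb.2) @[Fb --> V] --> lam2 (px (i l) b').
    have -> : lam2 (px (i l) b') =
        ulim V (fun Fb : T => lamF Fb.1 (px (i l) Fb.2)).
      rewrite -psiE lam2E; congr ulim; apply/funext => Fb.
      by rewrite psiE.
    apply: cvg_ulim => // Fb.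
    by rewrite (fa_ge0 (KF Fb : fin_additive _ _))
      (fa_le1 (KF Fb : fin_additive (fun s : nat * X -> U => sum_case s id) _)).
  apply: (cvgr_to_ge (cvg_norm (cvgB cf cl))).
  by apply: filterS (BV (l.+1, [::])) => Fb [_ h]; exact: h.
have [N _ NP] := (cvgrPdist_lt _ _).1 (samu.2 (inst p b') lam2 KM2) _ d0.
(* The bad index [i N] lies in the range where self-averaging of [lam2] forces a discrepancy below
   [d]. *)
have Ni : (N <= i N)%N.
  elim: (N) => // k IH; exact: leq_ltn_trans (ii k).
by have := far N; apply/negP; rewrite -ltNge; exact: NP Ni.
Qed.

End self_averaging_implies_fam.

Theorem theorem2p7 (R : realType) (L : language) (T : theory L)
    (U : structure L) (K : Type) (M : set U) (X : finType)
    (mu : formula L (X + U) -> R)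
    (complT : complete_theory T) (modelU : models U T) (monsterU : monster K U)
    (smallM : small K M) (elemM : elementary_substructure M)
    (measmu : keisler_measure mu) (bdmu : borel_definable M mu) :
  (fim M mu -> self_averaging M mu) /\ (self_averaging M mu -> fam M mu).
Proof.
split; first exact: (fim_self_averaging monsterU).
exact: (self_averaging_fam monsterU).
Qed.
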